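(* Let $\mathsf A=\mathsf A(z)$ be an $\mathsf n\times\mathsf n$ matrix of rational functions in $\mathbb C(z)$, let $\Delta\in\mathbb C[z]$ be a common denominator of its entries (so $\Delta\mathsf A$ has entries in $\mathbb C[z]$), and let $\mathfrak R\subset\mathbb C$ be a finitely generated $\mathbb Z$-algebra containing the coefficients of $\Delta$ and of the entries of $\Delta\mathsf A$. Define $\mathsf A_1=\mathsf A$, $\mathsf A_{m+1}=\frac{\partial \mathsf A_m}{\partial z}+\mathsf A_m\mathsf A$. If all the entries of all solutions of $\frac{\partial y}{\partial z}=\mathsf A y$ are algebraic functions over $\mathbb C(z)$, then there is a nonzero $N\in\mathfrak R$ such that for all $m\in\mathbb N$ the entries of $$\frac{(N\Delta)^m\cdot\mathsf A_m}{m!}$$ are in $\mathfrak R[z]$. In particular, for all primes $p$ and all $k,m\in\mathbb N$ with $\mathrm{ord}_p(m!)\ge k$, the matrix $\mathsf A_m$ is zero in the ring $\mathfrak R[z,\frac1{N\Delta}]/p^k\,\mathfrak R[z,\frac{1}{N\Delta}]$.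
   Context: Solutions of $\frac{\partial y}{\partial z}=\mathsf A y$ are $\mathsf n\times 1$ matrices $y$ whose entries are holomorphic functions on an open subset of $\mathbb C$. For such a solution $\frac{\partial^m y}{\partial z^m}=\mathsf A_m y$, and $\Delta^m\mathsf A_m$ has entries in $\mathfrak R[z]$. $\mathrm{ord}_p$ is the $p$-adic valuation. *)

(* Defs.v *)
From HB Require Import structures.
From mathcomp Require Import all_boot all_order all_algebra.
From mathcomp Require Import ring complex.
From mathcomp Require Import boolp classical_sets reals topology normedtype derive.
Import Order.TTheory GRing.Theory Num.Theory.
Import numFieldNormedType.Exports.

Set Implicit Arguments.
Unset Strict Implicit.
Unset Printing Implicit Defensive.

Local Open Scope ring_scope.

Notation ratfun K := {fraction {poly K}}.

Lemma div_eq_cross (F : fieldType) (a b c d : F) :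
  b != 0 -> d != 0 -> a / b = c / d <-> a * d = c * b.
Proof.
move=> b0 d0; split=> [E | E]; last by apply/eqP; rewrite eqr_div // E.
by apply/eqP; rewrite -eqr_div // E.
Qed.

Section RationalFunctions.
Variable K : numFieldType.
Implicit Types (f : ratfun K) (p q : {poly K}) (z : K).

(* Numerator and denominator in lowest terms; [repr f] alone is an arbitrary
   fraction representing [f]. *)
Definition rfnum f : {poly K} :=
  let r := repr f in \n_r %/ gcdp \n_r \d_r.
Definition rfden f : {poly K} :=
  let r := repr f in \d_r %/ gcdp \n_r \d_r.

Definition rfderiv f : ratfun K :=
  tofrac ((rfnum f)^`() * rfden f - rfnum f * (rfden f)^`())
  / tofrac (rfden f) ^+ 2.

Definition rfpole f z : bool := root (rfden f) z.

(* Meaningful only when [z] is not a pole of [f]. *)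
Definition rfval z f : K := (rfnum f).[z] / (rfden f).[z].

(* The three definitions above do not depend on the choice of representatives:
   see [rfderiv_frac], [rfpole_frac] and [rfval_frac]. *)

Lemma rfden_neq0 f : rfden f != 0.
Proof.
have d0 : \d_(repr f) != 0 := denom_ratioP (repr f).
by rewrite /rfden dvdp_div_eq0 ?dvdp_gcdr.
Qed.

Lemma rf_coprime f : coprimep (rfnum f) (rfden f).
Proof.
have d0 : \d_(repr f) != 0 := denom_ratioP (repr f).
by rewrite /rfnum /rfden coprimep_div_gcd // d0 orbT.
Qed.

Lemma frac_eq p q p' q' : q != 0 -> q' != 0 ->
  (tofrac p / tofrac q = tofrac p' / tofrac q' :> ratfun K) <->
  (p * q' = p' * q).
Proof.
rewrite -!(tofrac_eq0 (R := {poly K})) => q0 q'0.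
split=> [E | E].
  have /eqP := iffLR (div_eq_cross _ _ q0 q'0) E.
  by rewrite -(tofracM p) -(tofracM p') tofrac_eq => /eqP.
apply/(div_eq_cross _ _ q0 q'0).
by rewrite -(tofracM p) -(tofracM p') E.
Qed.

Lemma rfE f : f = tofrac (rfnum f) / tofrac (rfden f).
Proof.
have d0 : \d_(repr f) != 0 := denom_ratioP (repr f).
have fE : f = tofrac \n_(repr f) / tofrac \d_(repr f).
  rewrite -[in LHS](reprK f).
  have D0 : tofrac \d_(repr f) != 0 :> ratfun K by rewrite tofrac_eq0.
  apply: (mulIf D0); rewrite divfK //.
  rewrite !piE; apply/eqmodP; rewrite /= FracField.equivfE /FracField.mulf.
  by rewrite !numden_Ratio ?mulr1 ?mul1r ?oner_neq0 // mulrC.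
rewrite {1}fE; apply/frac_eq; rewrite ?rfden_neq0 //.
rewrite /rfnum /rfden [RHS]mulrC !divp_mulA ?dvdp_gcdl ?dvdp_gcdr //.
by rewrite mulrC.
Qed.

Lemma rfderiv_frac p q : q != 0 ->
  rfderiv (tofrac p / tofrac q)
  = tofrac (p^`() * q - p * q^`()) / tofrac q ^+ 2.
Proof.
move=> q0; set f := _ / _.
have d0 := rfden_neq0 f.
have E := iffLR (frac_eq _ _ q0 d0) (rfE f).
have E' : p^`() * rfden f + p * (rfden f)^`()
          = (rfnum f)^`() * q + rfnum f * q^`().
  by rewrite -!derivM E.
rewrite /rfderiv -!tofracXn; apply/frac_eq; rewrite ?expf_neq0 //.
move: E E'; set a := rfnum f; set b := rfden f => E E'.
have -> : (a^`() * b - a * b^`()) * q ^+ 2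
        = b * q * (a^`() * q) - q * b^`() * (a * q).
  by rewrite mulrBl !expr2; congr (_ - _); ring.
have -> : a^`() * q = p^`() * b + p * b^`() - a * q^`().
  by rewrite E' addrK.
rewrite -E.
have -> : b * q * (p^`() * b + p * b^`() - a * q^`())
   = b * q * (p^`() * b + p * b^`()) - b * q^`() * (a * q) by ring.
by rewrite -E; ring.
Qed.

Lemma rfpole_frac p q z : q.[z] != 0 -> ~~ rfpole (tofrac p / tofrac q) z.
Proof.
move=> qz; set f := _ / _.
have q0 : q != 0 by apply: contraNneq qz => ->; rewrite horner0.
have E := iffLR (frac_eq _ _ q0 (rfden_neq0 f)) (rfE f).
have dq : rfden f %| q.
  by rewrite -(@Gauss_dvdpr _ _ (rfnum f)) -?E ?dvdp_mull // coprimep_sym rf_coprime.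
apply: contra qz; rewrite /rfpole -dvdp_XsubCl => /dvdp_trans-/(_ _ dq).
by rewrite dvdp_XsubCl rootE.
Qed.

Lemma rfval_frac p q z : q.[z] != 0 ->
  rfval z (tofrac p / tofrac q) = p.[z] / q.[z].
Proof.
move=> qz; have := rfpole_frac p qz; rewrite /rfval /rfpole; set f := _ / _.
rewrite rootE => dz.
have q0 : q != 0 by apply: contraNneq qz => ->; rewrite horner0.
have E := iffLR (frac_eq _ _ q0 (rfden_neq0 f)) (rfE f).
by apply/eqP; rewrite GRing.eqr_div // -!hornerM E.
Qed.

End RationalFunctions.

Section DifferentialSystem.
Variable K : numFieldType.

(* Indexed so that [y^(m) = sysder A m * y] for every solution [y] of
   [y' = A y]; see [sysder1]. *)
Fixpoint sysder n (A : 'M[ratfun K]_n) (m : nat) : 'M[ratfun K]_n :=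
  if m is m'.+1 then map_mx (@rfderiv K) (sysder A m') + sysder A m' *m A
  else 1%:M.

Lemma sysder1 n (A : 'M[ratfun K]_n) : sysder A 1 = A.
Proof.
rewrite /= mul1mx -[RHS]add0r; congr (_ + _); apply/matrixP => i j.
rewrite !mxE; set b := _%:R.
have -> : b = tofrac (i == j)%:R / tofrac 1.
  by rewrite /b rmorph1 divr1 rmorph_nat.
rewrite rfderiv_frac ?oner_neq0 //.
by rewrite -polyC_natr -polyC1 !derivC mul0r mulr0 subrr rmorph0 mul0r.
Qed.

(* [U] is required to be connected: on infinitely many disjoint discs even a
   locally constant function need not satisfy a single algebraic equation.
   [U] may contain poles of [A], where the equation has no literal meaning. *)
Definition is_solution n (A : 'M[ratfun K]_n) (U : set K) (y : K -> 'cV[K]_n) :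
    Prop :=
  [/\ open U, connected U,
      forall (z : K) i, U z -> derivable (fun w => y w i 0) z 1
    & forall z : K, U z -> (forall i j, ~~ rfpole (A i j) z) ->
      \col_i derive1 (fun w => y w i 0) z = map_mx (rfval z) A *m y z].

(* The identity [P(f) = 0] is tested away from the finitely many poles of the
   coefficients of [P]. *)
Definition algebraic_function (U : set K) (f : K -> K) : Prop :=
  exists2 P : {poly ratfun K}, P != 0 &
    forall z : K, U z -> (forall k, ~~ rfpole P`_k z) ->
      \sum_(k < size P) rfval z P`_k * f z ^+ k = 0.

Definition finitely_generated_ring (S : subringClosed K) : Prop :=
  exists2 s : seq K, {subset s <= S} &
    forall T : subringClosed K, {subset s <= T} -> {subset S <= T}.

(* The subrings [S[z]] and [S[z, 1/h]] of the field of rational functions. *)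
Definition in_polyring (S : {pred K}) (f : ratfun K) : Prop :=
  exists2 q : {poly K}, q \is a polyOver S & f = tofrac q.

Definition in_localized_polyring (S : {pred K}) (h : {poly K}) (f : ratfun K) :
    Prop :=
  exists2 q : {poly K}, q \is a polyOver S &
    exists e : nat, f = tofrac q / tofrac h ^+ e.

End DifferentialSystem.

(* Main.v *)
Require Import Defs.
From HB Require Import structures.
From mathcomp Require Import all_boot all_order all_algebra.
From mathcomp Require Import ring lra zify complex.
From mathcomp Require Import boolp classical_sets functions cardinality.
From mathcomp Require Import reals topology normedtype derive sequences.
From mathcomp Require Import constructive_ereal measure lebesgue_measure.
Import Order.TTheory GRing.Theory Num.Theory.
Import numFieldNormedType.Exports.
Set Implicit Arguments.
Unset Strict Implicit.
Unset Printing Implicit Defensive.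
Local Open Scope ring_scope.

(** Fix a point [z0] with [Delta.[z0] != 0].  The solution with value [v] at
    [z0] has the Taylor coefficients [A_m(z0) v / m!], so the hypothesis says
    that the entries of the series [sum_m A_m(z0)/m! x^m] are algebraic over
    [C(x)].  By Eisenstein's theorem the coefficients of an algebraic power
    series have denominators of geometric growth: some [D != 0] in the ring
    [S[z0]] makes all [D^m A_m(z0)/m!] with [m > 0] lie in [S[z0]]
    ([eisenstein]).

    This is a statement about one point, but the point is free.  The ring [S]
    is countable, so [z0] may be taken transcendental over its fraction field
    ([exists_transcendental]); evaluation at [z0] then identifies [S[z]] with
    [S[z0]].  Writing [D = q(z0)] and [P_m = Delta^m A_m], a matrix of
    polynomials over [S], one gets [q^m P_m / m! = Delta^m w] with [w] over [S],
    as an identity of polynomials in [z].  Dividing by [q^m] costs only powers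
    of the leading coefficient [c] of [q]: the exponent needed is [m] plus the
    degree of [P_m / m!] ([divide_by_power]), and that degree grows at most
    linearly in [m].  Hence a fixed power of [c] serves as [N].  The
    divisibility by [p^k] follows because [p^k] divides [m!].

    Three points need work.  The algebraic equations given by the hypothesis
    have complex coefficients, while Eisenstein's theorem speaks of the ring
    generated by the equation; linear algebra replaces them by equations over
    [S[z0]] ([algebraic_descent]).  The hypothesis speaks of actual solutions,
    so the power series has to be summed near [z0] and shown to solve the system
    ([local_solution]).  Finally the equation satisfied by the sum has to become
    an identity of power series: inserting the partial sum of order [M] in the
    equation gives a polynomial that is [O(|x|^M)] near [0], hence divisible by
    ['X^M] ([series_root_of_vanishing]).  For this reason power series are
    handled throughout as sequences of coefficients with congruences modulo
    powers of ['X] between their truncations. *)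

(** * Solutions of linear systems over a subring *)

Section Descent.
Variables (L : idomainType) (A : subringClosed L).

(** Gaussian elimination without division, on an arbitrary family of equations:
    an equation with nonzero first coefficient eliminates the first unknown from
    all the others.  The induction is on the number of unknowns, so the family of
    equations may be infinite. *)
Lemma linear_descent_ord (I : Type) N (c : I -> 'I_N -> L) :
  (forall k i, c k i \in A) ->
  (exists2 p : 'I_N -> L, exists i, p i != 0 &
     forall k, \sum_i c k i * p i = 0) ->
  exists p : 'I_N -> L, [/\ forall i, p i \in A, exists i, p i != 0 &
     forall k, \sum_i c k i * p i = 0].
Proof.
elim: N c => [|N IHN] c cA [p [i0 p0] pc]; first by case: i0 {p0}.
have [[k0 ck0]|] := pselect (exists k, c k ord0 != 0); last first.
  move=> /forallNP c0; exists (fun i => (i == ord0)%:R); split => [i||k].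
  - by rewrite rpred_nat.
  - by exists ord0; rewrite eqxx oner_eq0.
  - rewrite big_ord_recl eqxx mulr1 big1 ?addr0; last by move=> i _; rewrite mulr0.
    by apply/eqP/negPn/negP/c0.
pose a := c k0 ord0.
(* Cross-multiplying instead of dividing keeps the new equations over [A]. *)
pose c' k (i : 'I_N) := a * c k (lift ord0 i) - c k ord0 * c k0 (lift ord0 i).
have aA : a \in A by apply: cA.
have [||q [qA [i1 q1] qc]] := IHN c'.
- by move=> k i; rewrite rpredB ?rpredM.
- have E k : \sum_(i < N) c k (lift ord0 i) * p (lift ord0 i) = - (c k ord0 * p ord0).
    apply/eqP; rewrite -addr_eq0 addrC; apply/eqP.
    by rewrite -[RHS](pc k) big_ord_recl.
  exists (fun i => p (lift ord0 i)).
    apply: contrapT => /forallNP pl0.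
    have pl i : p (lift ord0 i) = 0 by apply/eqP/negPn/negP/pl0.
    move/esym/eqP: (E k0); rewrite big1; last by move=> i _; rewrite pl mulr0.
    rewrite oppr_eq0 mulf_eq0 (negbTE ck0) /= => /eqP p00.
    by move: p0; case: (unliftP ord0 i0) => [j|] ->; rewrite ?pl ?p00 eqxx.
  move=> k; under eq_bigr do rewrite mulrBl -!mulrA.
  by rewrite sumrB -!mulr_sumr !E /a; ring.
exists (fun i => if unlift ord0 i is Some j then a * q j
        else - \sum_(j < N) c k0 (lift ord0 j) * q j); split.
- move=> i; case: unliftP => [j|] _; first by rewrite rpredM.
  by rewrite rpredN rpred_sum // => j _; rewrite rpredM.
- by exists (lift ord0 i1); rewrite liftK mulf_neq0.
- move=> k; rewrite big_ord_recl unlift_none mulrN mulr_sumr addrC -[RHS](qc k) -sumrB.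
  apply: eq_bigr => j _; rewrite liftK /c'; ring.
Qed.

Lemma linear_descent (I : Type) (T : finType) (c : I -> T -> L) :
  (forall k t, c k t \in A) ->
  (exists2 p : T -> L, exists t, p t != 0 & forall k, \sum_t c k t * p t = 0) ->
  exists p : T -> L, [/\ forall t, p t \in A, exists t, p t != 0 &
     forall k, \sum_t c k t * p t = 0].
Proof.
move=> cA [p [t0 p0] pc].
have E (F : T -> L) : \sum_t F t = \sum_(i < #|T|) F (enum_val i).
  exact: (big_enum_val (A := T)).
have [||q [qA [i qi] qc]] := @linear_descent_ord I #|T| (fun k i => c k (enum_val i)).
- by move=> k i; apply: cA.
- exists (fun i => p (enum_val i)); last by move=> k; rewrite -(E (fun t => c k t * p t)).
  by exists (enum_rank t0); rewrite enum_rankK.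
- exists (fun t => q (enum_rank t)); split => //.
  + by exists (enum_val i); rewrite enum_valK.
  + by move=> k; rewrite E -[RHS](qc k); apply: eq_bigr => j _; rewrite enum_valK.
Qed.

End Descent.

(** * Power series through their truncations *)

Section Truncation.
Variable L : comNzRingType.
Implicit Types (p q : {poly L}) (P : {poly {poly L}}) (a : nat -> L).

Definition eqmodX (M : nat) p q := forall k, (k < M)%N -> p`_k = q`_k.

Lemma eqmodX_sym M p q : eqmodX M p q -> eqmodX M q p.
Proof. by move=> h k /h. Qed.

Lemma eqmodX_trans M p q r : eqmodX M p q -> eqmodX M q r -> eqmodX M p r.
Proof. by move=> h h' k kM; rewrite h // h'. Qed.

Lemma eqmodXW M M' p q : (M' <= M)%N -> eqmodX M p q -> eqmodX M' p q.
Proof. by move=> le h k kM; apply: h; apply: leq_trans kM le. Qed.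

Lemma eqmodXD M p q p' q' :
  eqmodX M p q -> eqmodX M p' q' -> eqmodX M (p + p') (q + q').
Proof. by move=> h h' k kM; rewrite !coefD h // h'. Qed.

Lemma eqmodXN M p q : eqmodX M p q -> eqmodX M (- p) (- q).
Proof. by move=> h k kM; rewrite !coefN h. Qed.

Lemma eqmodXM M p q p' q' :
  eqmodX M p q -> eqmodX M p' q' -> eqmodX M (p * p') (q * q').
Proof.
move=> h h' k kM; rewrite !coefM; apply: eq_bigr => i _.
rewrite h ?h' //; first by apply: leq_ltn_trans kM; rewrite leq_subr.
by apply: leq_trans kM; apply: ltn_ord.
Qed.

Lemma eqmodX_sum M (I : Type) (s : seq I) (F G : I -> {poly L}) :
  (forall i, eqmodX M (F i) (G i)) ->
  eqmodX M (\sum_(i <- s) F i) (\sum_(i <- s) G i).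
Proof.
move=> h; elim: s => [|i s IH]; first by rewrite !big_nil.
by rewrite !big_cons; apply: eqmodXD.
Qed.

Lemma eqmodX_exp M p q n : eqmodX M p q -> eqmodX M (p ^+ n) (q ^+ n).
Proof.
by move=> h; elim: n => [|n IH]; rewrite ?expr0 // !exprS; apply: eqmodXM.
Qed.

Lemma eqmodX_horner M P p q : eqmodX M p q -> eqmodX M P.[p] P.[q].
Proof.
move=> h; elim/poly_ind: P => [|P c IH]; first by rewrite !horner0.
by rewrite !hornerMXaddC; apply: eqmodXD => //; apply: eqmodXM.
Qed.

Lemma eqmodX_Xn M M' p q :
  eqmodX (M + M') ('X^M * p) ('X^M * q) <-> eqmodX M' p q.
Proof.
split=> h k kM.
  have := h (M + k)%N; rewrite ltn_add2l => /(_ kM).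
  by rewrite !coefXnM ltnNge leq_addr /= addKn.
rewrite !coefXnM; case: ltnP => // Mk; apply: h; lia.
Qed.

Lemma eqmodX_Xn0 M p : eqmodX M p 0 -> p = 'X^M * drop_poly M p.
Proof.
move=> h; apply/polyP => k; rewrite coefXnM coef_drop_poly.
by case: ltnP => Mk; [rewrite h // coef0 | rewrite subnK].
Qed.

Lemma coef0_mulX p : p`_0 = 0 -> p = 'X * drop_poly 1 p.
Proof.
by move=> p0; rewrite -(expr1 'X); apply: eqmodX_Xn0 => -[|//] _; rewrite p0 coef0.
Qed.

Lemma eqmodX_mulX M p : eqmodX M ('X^M * p) 0.
Proof. by move=> k kM; rewrite coefXnM kM coef0. Qed.

Lemma eqmodX_eq p q : (forall M, eqmodX M p q) -> p = q.
Proof. by move=> h; apply/polyP => k; apply: (h k.+1). Qed.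

Definition trunc a M : {poly L} := \poly_(i < M) a i.

Lemma coef_trunc a M k : (trunc a M)`_k = if (k < M)%N then a k else 0.
Proof. exact: coef_poly. Qed.

Lemma trunc_eqmodX a M M' : (M <= M')%N -> eqmodX M (trunc a M') (trunc a M).
Proof. by move=> le k kM; rewrite !coef_trunc kM (leq_trans kM le). Qed.

(** [P(x, a) = 0] as a formal power series in [x], where [a] is the series with
    coefficients [a i] and the outer variable of [P] is replaced by [a]. *)
Definition series_root P a := forall M, eqmodX M P.[trunc a M] 0.

Lemma series_rootP P a :
  (forall k, P.[trunc a k.+1]`_k = 0) -> series_root P a.
Proof.
move=> h M k kM; rewrite coef0 -[RHS](h k).
exact: (eqmodX_horner P (trunc_eqmodX a kM) (ltnSn k)).
Qed.

End Truncation.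

(** * Coefficients in a subring and common denominators *)

(** Polynomials in two variables over [A], seen inside [{poly {poly L}}]. *)
Definition over2 (L : nzRingType) (A : {pred L}) (P : {poly {poly L}}) :=
  forall j, P`_j \is a polyOver A.

Section BivariateOver.
Variables (L : comNzRingType) (A : subringClosed L).
Implicit Types P Q : {poly {poly L}}.

Lemma over2D P Q : over2 A P -> over2 A Q -> over2 A (P + Q).
Proof. by move=> h h' j; rewrite coefD rpredD. Qed.

Lemma over2M P Q : over2 A P -> over2 A Q -> over2 A (P * Q).
Proof. by move=> h h' j; rewrite coefM rpred_sum // => i _; rewrite rpredM. Qed.

Lemma over2C (p : {poly L}) : p \is a polyOver A -> over2 A p%:P.
Proof. by move=> h [|j]; rewrite coefC ?rpred0. Qed.

Lemma over2X : over2 A 'X.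
Proof. by move=> j; rewrite coefX; case: eqP => _; rewrite ?rpred0 ?rpred1. Qed.

Lemma over2_comp P Q : over2 A P -> over2 A Q -> over2 A (P \Po Q).
Proof.
move=> + h'; elim/poly_ind: P => [|P p IH] h.
  by rewrite comp_poly0 => j; rewrite coef0 rpred0.
rewrite comp_poly_MXaddC; apply: over2D.
  by apply: over2M => //; apply: IH => j; have := h j.+1; rewrite coefD coefMX coefC addr0.
by apply: over2C; have := h 0%N; rewrite coefD coefMX coefC add0r.
Qed.

Lemma over2_drop n P : over2 A P -> over2 A (drop_poly n P).
Proof. by move=> h j; rewrite coef_drop_poly. Qed.

Lemma over2_deriv P : over2 A P -> over2 A P^`().
Proof. by move=> h j; rewrite coef_deriv rpredMn. Qed.

End BivariateOver.

Section Fractions.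
Variables (L : fieldType) (A : subringClosed L).

(** The fraction field of [A] inside [L]. *)
Definition fracs : {pred L} :=
  [pred x | `[< exists2 d, d \in A & d != 0 /\ d * x \in A >]].

Lemma fracsP x : reflect (exists2 d, d \in A & d != 0 /\ d * x \in A) (x \in fracs).
Proof. exact: asboolP. Qed.

Lemma fracs_subring_closed : subring_closed fracs.
Proof.
split.
- by apply/fracsP; exists 1; rewrite ?mulr1 ?oner_neq0 ?rpred1.
- move=> x y /fracsP[d dA [d0 dx]] /fracsP[e eA [e0 ey]]; apply/fracsP.
  exists (d * e); first by rewrite rpredM.
  rewrite mulf_neq0 //; split=> //.
  have -> : d * e * (x - y) = e * (d * x) - d * (e * y) by ring.
  by apply: rpredB; apply: rpredM.
- move=> x y /fracsP[d dA [d0 dx]] /fracsP[e eA [e0 ey]]; apply/fracsP.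
  exists (d * e); first by rewrite rpredM.
  rewrite mulf_neq0 //; split=> //.
  have -> : d * e * (x * y) = (d * x) * (e * y) by ring.
  by rewrite rpredM.
Qed.

HB.instance Definition _ := GRing.isSubringClosed.Build L fracs fracs_subring_closed.

Lemma sub_fracs x : x \in A -> x \in fracs.
Proof. by move=> xA; apply/fracsP; exists 1; rewrite ?mul1r ?oner_neq0 ?rpred1. Qed.

Lemma fracs_div x d : d \in A -> d != 0 -> d * x \in A -> x \in fracs.
Proof. by move=> dA d0 dx; apply/fracsP; exists d. Qed.

Lemma common_denominator_seq (s : seq L) : {subset s <= fracs} ->
  exists2 d, d \in A & d != 0 /\ forall x, x \in s -> d * x \in A.
Proof.
elim: s => [|x s IH] sF; first by exists 1; rewrite ?oner_neq0 ?rpred1.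
have [|d dA [d0 ds]] := IH; first by move=> y ys; apply: sF; rewrite inE ys orbT.
have /fracsP[e eA [e0 ex]] : x \in fracs by apply: sF; rewrite inE eqxx.
exists (d * e); first by rewrite rpredM.
rewrite mulf_neq0 //; split=> // y; rewrite inE => /predU1P[->|/ds dy].
  by rewrite -mulrA rpredM.
by rewrite mulrAC mulrC rpredM.
Qed.

Lemma common_denominator_poly (p : {poly L}) : p \is a polyOver fracs ->
  exists2 d, d \in A & d != 0 /\ d *: p \is a polyOver A.
Proof.
move=> pF; have [|d dA [d0 dp]] := @common_denominator_seq p.
  by move=> x /(nthP 0)[i _ <-]; apply: (polyOverP pF).
exists d => //; split=> //; apply/polyOverP => i; rewrite coefZ.
have [lt|ge] := ltnP i (size p); first by rewrite dp ?mem_nth.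
by rewrite nth_default // mulr0 rpred0.
Qed.

Lemma common_denominator_poly2 (P : {poly {poly L}}) :
  over2 fracs P ->
  exists2 d, d \in A & d != 0 /\ over2 A (d%:P *: P).
Proof.
elim/poly_ind: P => [|P p IH] PF.
  exists 1; rewrite ?rpred1 // oner_neq0; split=> // j.
  by rewrite coefZ coef0 mulr0 rpred0.
have pF : p \is a polyOver fracs.
  by have := PF 0%N; rewrite coefD coefMX coefC add0r.
have [|d dA [d0 dP]] := IH.
  by move=> i; have := PF i.+1; rewrite coefD coefMX coefC /= addr0.
have [e eA [e0 ep]] := common_denominator_poly pF.
exists (d * e); first by rewrite rpredM.
rewrite mulf_neq0 //; split=> // -[|j]; rewrite coefZ coefD coefMX coefC /=.
  by rewrite add0r polyCM -mulrA rpredM ?polyOverC // mul_polyC.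
rewrite addr0 mulrC polyCM mulrA rpredM ?polyOverC //.
by have := dP j; rewrite coefZ mulrC.
Qed.

End Fractions.

(** * Eisenstein's theorem *)

Lemma horner_drop2 (R : comNzRingType) (P : {poly R}) w :
  P.[w] = (drop_poly 2 P).[w] * w ^+ 2 + P`_1 * w + P`_0.
Proof.
rewrite -[in LHS](poly_take_drop 2 P) hornerD hornerM hornerXn addrC -addrA.
congr (_ + _); rewrite (@horner_coef_wide _ 2) ?size_take_poly //.
by rewrite !big_ord_recr big_ord0 /= !coef_take_poly /= expr0 expr1 add0r mulr1 addrC.
Qed.

Section Eisenstein.
Variables (L : fieldType) (A : subringClosed L).

Section Filtration.
Variable c : L.
Hypothesis cA : c \in A.

(** A filtration in which the variable has weight [2].  A series [v] without
    constant term has filtration [1] exactly when [c^(2k-1) v_k] lies in [A] for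
    all [k > 0], which is the bound wanted in [hensel_denominators];
    multiplicativity makes it stable under the nonlinear terms of the equation
    for [v]. *)
Definition wfilt (s : nat) (q : {poly L}) := forall k,
  if (2 * k < s)%N then q`_k = 0 else c ^+ (2 * k - s) * q`_k \in A.

Lemma wfilt0 q : q \is a polyOver A -> wfilt 0 q.
Proof. by move=> /polyOverP qA k; rewrite ltn0 rpredM ?rpredX. Qed.

Lemma wfiltW s t q : (t <= s)%N -> wfilt s q -> wfilt t q.
Proof.
move=> ts h k; have := h k; case: ltnP => ks; last first.
  rewrite ltnNge (leq_trans ts ks) /= => qk.
  have -> : (2 * k - t = (s - t) + (2 * k - s))%N by lia.
  by rewrite exprD -mulrA rpredM ?rpredX.
by move=> ->; case: ifP; rewrite // mulr0 rpred0.
Qed.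

Lemma wfiltD s p q : wfilt s p -> wfilt s q -> wfilt s (p + q).
Proof.
move=> hp hq k; have := hq k; have := hp k; rewrite coefD; case: ifP => _.
  by move=> -> ->; rewrite addr0.
by move=> ? ?; rewrite mulrDr rpredD.
Qed.

Lemma wfiltM s t p q : wfilt s p -> wfilt t q -> wfilt (s + t) (p * q).
Proof.
move=> hp hq k; rewrite coefM.
have h (i : 'I_k.+1) : if (2 * k < s + t)%N then p`_i * q`_(k - i) = 0
    else c ^+ (2 * k - (s + t)) * (p`_i * q`_(k - i)) \in A.
  have := hp i; have := hq (k - i)%N; have ik := ltn_ord i.
  have z0 : 0 = p`_i * q`_(k - i) -> if (2 * k < s + t)%N then p`_i * q`_(k - i) = 0
    else c ^+ (2 * k - (s + t)) * (p`_i * q`_(k - i)) \in A.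
    by move=> <-; case: ifP; rewrite // mulr0 rpred0.
  case: (ltnP (2 * (k - i)) t) => h1; first by move=> q0 _; apply: z0; rewrite q0 mulr0.
  case: (ltnP (2 * i) s) => h2; first by move=> _ p0; apply: z0; rewrite p0 mul0r.
  rewrite ltnNge (_ : (s + t <= 2 * k)%N) /=; last by lia.
  have -> : (2 * k - (s + t) = (2 * i - s) + (2 * (k - i) - t))%N by lia.
  by move=> qA pA; rewrite exprD mulrACA rpredM.
case: ifP h => _ h; first by rewrite big1.
by rewrite mulr_sumr rpred_sum.
Qed.

Lemma wfilt0_horner P v : over2 A P -> wfilt 0 v -> wfilt 0 P.[v].
Proof.
move=> + hv; elim/poly_ind: P => [|P p IH] h.
  by rewrite horner0; apply: wfilt0; rewrite rpred0.
rewrite hornerMXaddC; apply: wfiltD.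
  apply: (@wfiltM 0 0) => //; apply: IH => j.
  by have := h j.+1; rewrite coefD coefMX coefC addr0.
by apply: wfilt0; have := h 0%N; rewrite coefD coefMX coefC add0r.
Qed.

End Filtration.

(** Comparing coefficients of [x^m] determines [b m] from the earlier ones: with
    [c] the linear coefficient of [G] at [x = 0] and [v] the truncation of the
    series before [x^m], it gives [c * b m = - (R v)_m], where [R] consists of
    the terms of [G] other than [c * y].  Now [R v] has filtration [2]: the
    constant term and the rest of the linear term because their coefficients
    vanish at [x = 0], the higher terms because they contain [v^2].  So
    [c^(2m-2)] clears the denominator of [(R v)_m], and one more factor [c] that
    of [b m]. *)
Lemma hensel_denominators (G : {poly {poly L}}) (b : nat -> L) :
  let c := G`_1`_0 in
  over2 A G -> G`_0`_0 = 0 -> c != 0 -> b 0 = 0 -> series_root G b ->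
  forall m, (0 < m)%N -> c ^+ (2 * m).-1 * b m \in A.
Proof.
move=> c GA G00 c0 b0 Gb; have cA : c \in A by apply: (polyOverP (GA 1)).
elim/ltn_ind => m IH m0.
pose v := trunc b m; pose w := trunc b m.+1.
pose R y := (drop_poly 2 G).[y] * y ^+ 2 + (G`_1 - c%:P) * y + G`_0.
have GE y : G.[y] = R y + c *: y.
  by rewrite horner_drop2 /R -mul_polyC; ring.
have vX : v = 'X^1 * drop_poly 1 v.
  by apply: coef0_mulX; rewrite coef_trunc b0; case: ifP.
have wX : w = 'X^1 * drop_poly 1 w.
  by apply: coef0_mulX; rewrite coef_trunc b0.
have gX : G`_1 - c%:P = 'X^1 * drop_poly 1 (G`_1 - c%:P).
  by apply: coef0_mulX; rewrite coefB coefC subrr.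
have wv : eqmodX m w v by apply: trunc_eqmodX.
have wv1 : eqmodX m.-1 (drop_poly 1 w) (drop_poly 1 v).
  by move=> k km; rewrite !coef_drop_poly wv //; lia.
(* Both [y^2] and [(G_1 - c) y] carry a factor ['X^2], so replacing [w] by [v],
   which agree up to order [m], leaves the coefficient of ['X^m] unchanged. *)
have Rwv : (R w)`_m = (R v)`_m.
  suff : eqmodX m.+1 (R w) (R v) by apply.
  rewrite (_ : m.+1 = 2 + m.-1)%N; last by lia.
  apply: eqmodXD => //.
  have E (z g y g' y' : {poly L}) : g = 'X^1 * g' -> y = 'X^1 * y' ->
      z * y ^+ 2 + g * y = 'X^2 * (z * y' ^+ 2 + g' * y').
    by move=> -> ->; ring.
  rewrite (E _ _ _ _ _ gX vX) (E _ _ _ _ _ gX wX); apply/eqmodX_Xn.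
  apply: eqmodXD; last by apply: eqmodXM.
  apply: eqmodXM; last by apply: eqmodX_exp.
  by apply: eqmodX_horner; apply: eqmodXW wv; lia.
have vF : wfilt c 1 v.
  move=> [|k]; first by rewrite coef_trunc b0; case: ifP.
  rewrite coef_trunc; have -> : (2 * k.+1 < 1)%N = false by lia.
  case: ifP => km; last by rewrite mulr0 rpred0.
  by rewrite subn1; apply: IH.
have RF : wfilt c 2 (R v).
  apply: wfiltD; first apply: wfiltD.
  - apply: (@wfiltM c cA 0 2); last exact: (@wfiltM c cA 1 1).
    by apply: wfilt0_horner (wfiltW cA _ vF) => //; apply: over2_drop.
  - apply: (@wfiltM c cA 1 1) => // -[|k]; first by rewrite coefB coefC subrr.
    by rewrite coefB coefC subr0 /= rpredM ?rpredX // (polyOverP (GA 1)).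
  - move=> [|k] //; have -> : (2 * k.+1 < 2)%N = false by lia.
    by rewrite rpredM ?rpredX // (polyOverP (GA 0)).
have /(_ m) := Gb m.+1; rewrite ltnSn coef0 -/w GE => /(_ isT)/eqP.
rewrite coefD coefZ coef_trunc ltnSn Rwv.
rewrite addrC addr_eq0 => /eqP cb.
have := RF m; have -> : (2 * m < 2)%N = false by lia.
move=> RA.
by rewrite (_ : (2 * m).-1 = (2 * m - 2).+1)%N ?exprSr -?mulrA ?cb ?mulrN ?rpredN //; lia.
Qed.

Implicit Types (a : nat -> L) (P : {poly {poly L}}).

Definition geometric_denominators a :=
  exists2 D, D \in A & D != 0 /\ forall m, (0 < m)%N -> D ^+ m * a m \in A.

(** When [P'] does not vanish at the series [a], let [r] be the order in [x] of
    [P'(x, a)], and write [a = u + x^r v] with [u] the truncation of [a] after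
    [x^r], so that [v] has no constant term.  In the Taylor expansion of
    [P(x, u + x^r v)] around [u] every term is divisible by [x^(2r)], the
    constant one because the whole vanishes.  Dividing by [x^(2r)] leaves an
    equation for [v] whose linear coefficient is nonzero at [x = 0], the case of
    [hensel_denominators]. *)
Lemma eisenstein_simple_root a P :
  (forall i, a i \in fracs A) -> over2 A P -> series_root P a ->
  ~ series_root P^`() a -> geometric_denominators a.
Proof.
move=> aF PA Pa P'a.
have exr : exists k, P^`().[trunc a k.+1]`_k != 0.
  apply: contrapT => /forallNP h; apply: P'a; apply: series_rootP => k.
  by apply/eqP/negPn/negP/h.
have [r r_neq0 r_min] := ex_minnP exr.
pose u := trunc a r.+1; pose b m := if m is 0 then 0 else a (m + r)%N.
have aE M : trunc a (r + M.+1) = u + 'X^r * trunc b M.+1.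
  apply/polyP => k; rewrite coefD coefXnM !coef_trunc.
  case: (ltnP k r) => kr; first by rewrite (_ : (k < r + M.+1)%N) ?ltnS ?(ltnW kr) ?addr0 //; lia.
  rewrite /b ltnS; case: (ltngtP k r) kr => // [kr _|-> _].
    rewrite (_ : (k - r < M.+1)%N = (k < r + M.+1)%N) ?add0r; last by lia.
    by case: (k - r)%N (subnK (ltnW kr)) (kr) => [<-|j ->]; rewrite ?ltnn.
  by rewrite subnn addr0 (_ : (r < r + M.+1)%N) //; lia.
pose Q := P \Po ('X + u%:P).
have Q0 : Q`_0 = P.[u] by rewrite -horner_coef0 horner_comp !hornerE.
have Q1 : Q`_1 = P^`().[u].
  rewrite -[1%N]addn1 -[LHS]mulr1n -coef_deriv -horner_coef0 deriv_comp.
  by rewrite derivD derivX derivC addr0 mulr1 horner_comp !hornerE.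
pose H := drop_poly 2 Q.
(* [Q] is [P] recentred at [u]; only its first two coefficients have to be
   inspected, [H] collects the others. *)
have QE v : P.[u + 'X^r * v]
    = H.['X^r * v] * ('X^(2 * r) * v ^+ 2) + Q`_1 * 'X^r * v + Q`_0.
  have -> : P.[u + 'X^r * v] = Q.['X^r * v].
    by rewrite /Q horner_comp !hornerE addrC.
  rewrite horner_drop2 -/H mul2n -addnn exprD.
  by move: 'X^r Q`_0 Q`_1 H.[_] => x q0 q1 h; ring.
have Q1X : Q`_1 = 'X^r * drop_poly r Q`_1.
  apply: eqmodX_Xn0 => k kr; rewrite coef0 Q1.
  rewrite (eqmodX_horner P^`() (trunc_eqmodX a (_ : k.+1 <= r.+1)%N)) //; last by lia.
  by apply/eqP; apply: contraTT kr => /r_min; rewrite -leqNgt.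
have Q0X : eqmodX (2 * r).+1 Q`_0 0.
  have := Pa (r + r.+1)%N; rewrite aE QE; set v := trunc b r.+1 => Pv.
  have vX : v = 'X^1 * drop_poly 1 v.
    by apply: eqmodX_Xn0 => -[|//] _; rewrite coef_trunc coef0.
  have XR (q : {poly L}) : eqmodX (2 * r).+1 ('X^(r + r.+1) * q) 0.
    by rewrite (_ : r + r.+1 = (2 * r).+1)%N; [apply: eqmodX_mulX | lia].
  have -> : Q`_0 = (H.['X^r * v] * ('X^(2 * r) * v ^+ 2) + Q`_1 * 'X^r * v + Q`_0)
     - 'X^(r + r.+1) * (H.['X^r * v] * drop_poly 1 v * v + drop_poly r Q`_1 * drop_poly 1 v).
    set z := H.[_]; set w := drop_poly r _; rewrite [in RHS]Q1X -/w.
    move: vX; set v' := drop_poly 1 v => ->.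
    rewrite mul2n -addnn -[r.+1]addn1 !exprD.
    by clearbody z w v'; move: 'X^r Q`_0 => x q0; ring.
  rewrite -[X in eqmodX _ _ X]subr0; apply: eqmodXD; last by apply: eqmodXN; apply: XR.
  by apply: eqmodXW Pv; lia.
pose G := (H \Po ('X^r *: 'X)) * 'X^2 + (drop_poly r Q`_1)%:P * 'X
          + (drop_poly (2 * r) Q`_0)%:P.
have Gcoef k : G`_k = if k is 0 then drop_poly (2 * r) Q`_0 else
    if k is 1 then drop_poly r Q`_1 else G`_k.
  case: k => [|[|k]] //; rewrite !coefD coefMXn coefMX coefC /=.
    by rewrite coefC /= !add0r.
  by rewrite coefC /= add0r addr0.
have GP v : P.[u + 'X^r * v] = 'X^(2 * r) * G.[v].
  rewrite QE /G !hornerD !hornerM horner_comp !hornerC hornerZ !hornerX -expr2 [in LHS]Q1X.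
  have Q0E : Q`_0 = 'X^(2 * r) * drop_poly (2 * r) Q`_0 :> {poly L}.
    by apply: eqmodX_Xn0; apply: eqmodXW Q0X.
  rewrite [in LHS]Q0E.
  move: (drop_poly (2 * r) _) (drop_poly r _) => q0 q1.
  rewrite mul2n -addnn exprD; move: 'X^r H.[_] => x h; ring.
have Gb : series_root G b.
  move=> M; have h : eqmodX M (trunc b M) (trunc b (M + r).+1).
    by apply/eqmodX_sym/trunc_eqmodX; lia.
  apply: eqmodX_trans (eqmodX_horner G h) _.
  apply/(eqmodX_Xn (2 * r)); rewrite mulr0 -GP -aE.
  by apply: eqmodXW (Pa _); lia.
have FP : over2 (fracs A) P.
  by move=> j; apply/polyOverP => i; apply/sub_fracs/(polyOverP (PA j)).
have uF : u \is a polyOver (fracs A).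
  by apply/polyOverP => i; rewrite coef_trunc; case: ifP => _; rewrite ?aF ?rpred0.
have FQ : over2 (fracs A) Q.
  by apply: over2_comp => //; apply: over2D; [exact: over2X | exact: over2C].
have Fdrop k (q : {poly L}) : q \is a polyOver (fracs A) ->
    drop_poly k q \is a polyOver (fracs A).
  by move=> qF; apply/polyOverP => i; rewrite coef_drop_poly (polyOverP qF).
have FG : over2 (fracs A) G.
  apply: over2D; last by apply/over2C/Fdrop.
  apply: over2D; last by apply: over2M; [apply/over2C/Fdrop | exact: over2X].
  apply: over2M; last by apply: over2M; exact: over2X.
  apply: over2_comp; first exact: over2_drop.
  by rewrite -mul_polyC; apply: over2M; [apply/over2C; rewrite rpredX ?polyOverX | exact: over2X].
have [e eA [e0 eG]] := common_denominator_poly2 FG.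
have eGcoef j k : (e%:P *: G)`_j`_k = e * G`_j`_k by rewrite coefZ coefCM.
have cE : (e%:P *: G)`_1`_0 != 0.
  by rewrite eGcoef mulf_neq0 // Gcoef coef_drop_poly add0n Q1.
have cA := polyOverP (eG 1%N) 0%N.
have /(_ eG) bA := @hensel_denominators (e%:P *: G) b.
have {}bA : forall m, (0 < m)%N -> (e%:P *: G)`_1`_0 ^+ (2 * m).-1 * b m \in A.
  apply: bA => //; first by rewrite eGcoef Gcoef coef_drop_poly add0n Q0X ?coef0 ?mulr0 //; lia.
  move=> M k kM; rewrite hornerZ coefCM Gb // coef0 mulr0 //.
set c := (e%:P *: G)`_1`_0 in cE cA bA.
have [d dA [d0 du]] := common_denominator_poly uF.
(* [d] clears the finitely many coefficients of [u], and [c ^+ 2] the rest. *)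
exists (c ^+ 2 * d); first by rewrite rpredM ?rpredX.
rewrite mulf_neq0 ?expf_neq0 //; split=> // m m0; rewrite exprMn.
case: (leqP m r) => mr.
  have := polyOverP du m; rewrite coefZ coef_trunc ltnS mr => dm.
  have -> : d ^+ m = d ^+ m.-1 * d by rewrite -exprSr prednK.
  by rewrite -!mulrA rpredM ?rpredX // rpredM ?rpredX.
have := bA (m - r)%N; rewrite subn_gt0 mr => /(_ isT).
have -> : b (m - r)%N = a m.
  by rewrite /b; case: (m - r)%N (subnK (ltnW mr)) (mr) => [<-|j ->]; rewrite ?ltnn.
move=> am; rewrite mulrAC -exprM (_ : 2 * m = (2 * r).+1 + (2 * (m - r)).-1)%N; last by lia.
by rewrite exprD -(mulrA (c ^+ _)) rpredM ?rpredX // rpredM ?rpredX.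
Qed.

(** Replacing [P] by its derivative as long as the latter still vanishes at [a]
    leads to the case of [eisenstein_simple_root]; it stops because in
    characteristic zero a nonzero [P] with zero derivative is a nonzero
    polynomial in [x] alone, and that does not vanish as a series. *)
Lemma eisenstein a P : [pchar L] =i pred0 ->
  (forall i, a i \in fracs A) -> over2 A P -> P != 0 -> series_root P a ->
  geometric_denominators a.
Proof.
move=> L0 aF; have [n] := ubnP (size P); elim: n P => // n IH P szP PA P0 Pa.
have [P'a|] := pselect (series_root P^`() a); last exact: (eisenstein_simple_root aF PA).
apply: (IH P^`()) => //.
- by apply: leq_trans (lt_size_deriv P0) _.
- exact: over2_deriv.
- apply: contra P0 => /eqP P'0.
  have PC : P = (P`_0)%:P.
    apply/polyP => -[|i]; rewrite coefC //=; apply/eqP.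
    have /eqP := congr1 (fun q : {poly {poly L}} => q`_i) P'0.
    rewrite coef_deriv coef0 -mulr_natr mulf_eq0 => /orP[//|].
    by rewrite -polyC_natr polyC_eq0 (pcharf0P L).1.
  rewrite PC polyC_eq0; apply/eqP/eqmodX_eq => M.
  by have := Pa M; rewrite {1}PC hornerC.
Qed.

(** The coefficients of [P] solve a homogeneous linear system, with one equation
    for each power of [x], whose coefficients are polynomials in the [a i].
    After clearing the denominators of each equation separately, the system
    is defined over [A] and has a nonzero solution there by [linear_descent]. *)
Lemma algebraic_descent a P : (forall i, a i \in fracs A) ->
  P != 0 -> series_root P a ->
  exists2 P', over2 A P' & P' != 0 /\ series_root P' a.
Proof.
move=> aF P0 Pa.
pose I := \max_(j < size P) size (P`_j)%R; pose J := size P.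
pose T := ('I_J * 'I_I)%type.
pose row k (t : T) := ('X^(t.2) * trunc a k.+1 ^+ t.1)`_k.
(* The bivariate polynomial with coefficients [p]. *)
pose bip (p : T -> L) : {poly {poly L}} :=
  \poly_(j < J) \poly_(i < I) oapp (fun j => oapp (fun i => p (j, i)) 0 (insub i)) 0 (insub j).
have bipE p k : (bip p).[trunc a k.+1]`_k = \sum_t row k t * p t.
  rewrite horner_poly coef_sum.
  rewrite (eq_bigr (fun t : T => row k (t.1, t.2) * p (t.1, t.2))); last by case.
  rewrite -(pair_bigA _ (fun j i => row k (j, i) * p (j, i))) /=.
  apply: eq_bigr => j _; rewrite poly_def mulr_suml coef_sum; apply: eq_bigr => i _.
  by rewrite !valK /= -scalerAl coefZ mulrC.
have rowF k t : row k t \in fracs A.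
  suff /polyOverP : 'X^(t.2) * trunc a k.+1 ^+ t.1 \is a polyOver (fracs A) by apply.
  rewrite rpredM ?rpredX ?polyOverX //; apply/polyOverP => i.
  by rewrite coef_trunc; case: ifP => _; rewrite ?aF ?rpred0.
have dP k : exists d, [/\ d \in A, d != 0 & forall t, d * row k t \in A].
  have [|d dA [d0 dr]] := @common_denominator_seq L A (codom (row k)).
    by move=> x /codomP[t ->].
  by exists d; split=> // t; apply: dr; apply: codom_f.
pose d k := projT1 (cid (dP k)).
have dE k : [/\ d k \in A, d k != 0 & forall t, d k * row k t \in A].
  by rewrite /d; case: cid.
have [||p [pA [t0 pt0] pE]] := @linear_descent L A nat T (fun k t => d k * row k t).
- by move=> k t; case: (dE k).
- pose p (t : T) := P`_t.1`_t.2.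
  have PE : P = bip p.
    apply/polyP => j; rewrite coef_poly; case: ltnP => jJ; last exact: nth_default.
    apply/polyP => i; rewrite coef_poly (insubT (fun j => j < J)%N jJ) /=; case: ltnP => iI.
      by rewrite (insubT (fun i => i < I)%N iI).
    apply: nth_default; apply: leq_trans iI.
    exact: (leq_bigmax (F := fun j : 'I_J => size (P`_j)%R) (Ordinal jJ)).
  exists p.
    apply: contrapT => /forallNP p0; move/eqP: P0; apply; rewrite PE.
    apply/polyP => j; rewrite coef0 coef_poly; case: ltnP => // jJ.
    apply/polyP => i; rewrite coef0 coef_poly; case: ltnP => // iI.
    rewrite (insubT (fun j => j < J)%N jJ) (insubT (fun i => i < I)%N iI) /=.
    by apply/eqP/negPn/negP/p0.
  move=> k; under eq_bigr do rewrite -mulrA.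
  by rewrite -mulr_sumr -bipE -PE (Pa k.+1) // coef0 mulr0.
exists (bip p).
  move=> j; rewrite coef_poly; case: ltnP => jJ; last by rewrite rpred0.
  apply/polyOverP => i; rewrite coef_poly; case: ltnP => iI; last by rewrite rpred0.
  by rewrite (insubT (fun j => j < J)%N jJ) (insubT (fun i => i < I)%N iI) /=.
split.
  apply: contra pt0 => /eqP bip0; case: t0 => j i.
  have := congr1 (fun q : {poly {poly L}} => q`_j`_i) bip0.
  by rewrite !coef0 coef_poly ltn_ord coef_poly ltn_ord !valK /= => ->.
apply: series_rootP => k; rewrite bipE; have [_ dk _] := dE k.
apply/eqP; rewrite -(mulrI_eq0 _ (mulfI dk)) mulr_sumr -[X in _ == X](pE k).
by apply/eqP; apply: eq_bigr => t _; rewrite mulrA.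
Qed.

(** Polynomial division from the top: the coefficient of degree [i] of a quotient
    by [D] needs one factor [c], the leading coefficient, for each step below
    the degree.  Dividing [m] times naively would cost about [m * e] factors.  The
    exponent [m + e] comes from recording, for each coefficient, its distance to
    the top degree, which is the same for dividend and quotient: each
    division then costs one more factor only. *)
Lemma divide_by_power (D q : {poly L}) (m e : nat) :
  D \is a polyOver A -> D != 0 -> D ^+ m * q \is a polyOver A ->
  (size q <= e.+1)%N -> lead_coef D ^+ (m + e) *: q \is a polyOver A.
Proof.
move=> DA D0 qA sq; set c := lead_coef D.
have cA : c \in A by apply: (polyOverP DA).
(* [n] bounds the degree of [w], so [n - i] is the distance to the top. *)
pose F t n (w : {poly L}) := forall i, c ^+ (t + n - i) * w`_i \in A.
pose d := (size D).-1.
have step t n (w : {poly L}) : (size w <= n.+1)%N -> F t (n + d)%N (D * w) -> F t.+1 n w.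
  move=> sw Dw i; have [k] := ubnP (n.+1 - i)%N; elim: k i => // k IH i ki.
  case: (leqP i n) => ni; last by rewrite nth_default ?mulr0 ?rpred0 // (leq_trans sw).
  have dlt : (d < (d + i).+1)%N by lia.
  have ci : c * w`_i = (D * w)`_(d + i)
      - \sum_(j < (d + i).+1 | j != Ordinal dlt) D`_j * w`_(d + i - j).
    by rewrite coefM (bigD1 (Ordinal dlt)) //= addrK addKn.
  have -> : (t.+1 + n - i = (t + n - i).+1)%N by lia.
  rewrite exprSr -mulrA ci mulrBr rpredB //.
    by have := Dw (d + i)%N; rewrite (_ : t + (n + d) - (d + i) = t + n - i)%N //; lia.
  rewrite mulr_sumr rpred_sum // => j; rewrite -val_eqE /= => jd.
  have [dj|dj] := ltnP d j.
    rewrite [D`_j]nth_default ?mul0r ?mulr0 ?rpred0 //.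
    exact: leq_trans (leqSpred _) dj.
  have {jd dj}jd : (j < d)%N by rewrite ltn_neqAle jd.
  rewrite mulrCA rpredM ?(polyOverP DA) //.
  have [jn|jn] := leqP (d + i - j)%N n; last first.
    by rewrite nth_default ?mulr0 ?rpred0 // (leq_trans sw).
  have -> : (t + n - i = (d - j).-1 + (t.+1 + n - (d + i - j)))%N by lia.
  by rewrite exprD -mulrA rpredM ?rpredX // IH //; lia.
have szD j : (size (D ^+ j * q)%R <= (e + j * d).+1)%N.
  elim: j => [|j IH]; first by rewrite expr0 mul1r addn0.
  rewrite exprS -mulrA; apply: leq_trans (size_polyMleq _ _) _.
  by move: IH; rewrite mulSn -/d; have := size_poly_gt0 D; rewrite D0 /d; lia.
have Fk k : (k <= m)%N -> F k (e + (m - k) * d)%N (D ^+ (m - k) * q).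
  elim: k => [_|k IH km]; first by move=> i; rewrite subn0 rpredM ?rpredX ?(polyOverP qA).
  apply: step; first exact: szD.
  have := IH (ltnW km); rewrite (_ : m - k = (m - k.+1).+1)%N; last by lia.
  by rewrite exprS -mulrA mulSn [(d + _)%N]addnC addnA.
have := Fk m (leqnn m); rewrite subnn expr0 mul1r addn0 => Fq.
apply/polyOverP => i; rewrite coefZ; have [ie|ie] := leqP i e; last first.
  by rewrite nth_default ?mulr0 ?rpred0 // (leq_trans sq).
have -> : (m + e = i + (m + e - i))%N by lia.
by rewrite exprD -mulrA rpredM ?rpredX //; apply: Fq.
Qed.

End Eisenstein.

(** * The matrices [Delta^m A_m] and formal solutions *)

Section Numerators.
Variables (K : numFieldType) (n : nat).
Implicit Types (Delta : {poly K}) (B : 'M[{poly K}]_n).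

(** [Delta ^+ m * sysder A m] as a matrix of polynomials, when [B] is
    [Delta * A]; see [sysder_numer]. *)
Fixpoint numer Delta B (m : nat) : 'M[{poly K}]_n :=
  if m is m'.+1 then
    Delta *: map_mx (@deriv K) (numer Delta B m')
    - (m'%:R * Delta^`()) *: numer Delta B m' + numer Delta B m' *m B
  else 1%:M.

Lemma numerS Delta B m i j : numer Delta B m.+1 i j =
  Delta * (numer Delta B m i j)^`() - m%:R * Delta^`() * numer Delta B m i j
  + \sum_k numer Delta B m i k * B k j.
Proof. by rewrite !mxE. Qed.

Lemma sysder_numer (A : 'M[ratfun K]_n) Delta B : Delta != 0 ->
  (forall i j, tofrac Delta * A i j = tofrac (B i j)) ->
  forall m i j, sysder A m i j = tofrac (numer Delta B m i j) / tofrac Delta ^+ m.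
Proof.
move=> D0 AB; have d0 : tofrac Delta != 0 :> ratfun K by rewrite tofrac_eq0.
elim=> [|m IH] i j.
  by rewrite !mxE expr0 divr1 !mulrb; case: eqP; rewrite ?rmorph1 ?rmorph0.
have AE k l : A k l = tofrac (B k l) / tofrac Delta.
  by rewrite -AB mulrAC divff ?mul1r.
rewrite /= !mxE IH -tofracXn rfderiv_frac ?expf_neq0 // deriv_exp.
rewrite (eq_bigr (fun k => tofrac (numer Delta B m i k * B k j)
    / tofrac Delta ^+ m.+1)); last first.
  by move=> k _; rewrite IH AE mulrACA -tofracM -invfM -exprSr.
rewrite -mulr_suml -rmorph_sum /= [in RHS]rmorphD mulrDl; congr (_ + _).
rewrite -!tofracXn; apply/frac_eq; rewrite ?expf_neq0 //.
set p := numer _ _ _ _ _; case: m {IH} @p => [|m] p.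
  by rewrite !expr0 expr1 !mulr0n mul0r; ring.
by rewrite -mulr_natr [Delta ^+ m.+2]exprS -/Delta exprS /=; ring.
Qed.

Lemma numer_over (S : subringClosed K) Delta B :
  Delta \is a polyOver S -> (forall i j, B i j \is a polyOver S) ->
  forall m i j, numer Delta B m i j \is a polyOver S.
Proof.
move=> DS BS; elim=> [|m IH] i j; first by rewrite mxE rpredMn ?rpred1.
rewrite numerS rpredD ?rpredB //.
- by rewrite rpredM ?polyOver_deriv.
- by rewrite rpredM // rpredM ?polyOver_deriv // rpred_nat.
- by rewrite rpred_sum // => k _; rewrite rpredM.
Qed.

(** Each step of the recursion raises the degree by at most the larger of the
    degrees of [Delta] and of the entries of [B]. *)
Lemma size_numer Delta B :
  exists d, forall m i j, (size (numer Delta B m i j) <= (m * d).+1)%N.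
Proof.
pose d := maxn (size Delta) (\max_i \max_j size (B i j)).
have sD : (size Delta <= d.+1)%N by rewrite leqW ?leq_maxl.
have sB i j : (size (B i j) <= d.+1)%N.
  rewrite leqW // leq_max; apply/orP; right.
  apply: leq_trans (leq_bigmax (F := fun i => \max_j size (B i j)) i).
  exact: (leq_bigmax (F := fun j => size (B i j))).
exists d; elim=> [|m IH] i j.
  by rewrite mxE mulrb; case: eqP; rewrite ?size_poly1 ?size_poly0.
have sM (p q : {poly K}) a b c :
    (size p <= a -> size q <= b -> a + b <= c.+1 -> size (p * q)%R <= c)%N.
  move=> sp sq abc; apply: leq_trans (size_polyMleq _ _) _; lia.
have sd (p : {poly K}) a : (size p <= a.+1 -> size p^`() <= a)%N.
  by move=> sp; have [->|p0] := eqVneq p 0; [rewrite deriv0 size_poly0|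
     have := lt_size_deriv p0; lia].
rewrite numerS mulSn; apply: leq_trans (size_polyD _ _) _; rewrite geq_max; apply/andP; split.
  apply: leq_trans (size_polyD _ _) _; rewrite geq_max size_polyN; apply/andP; split.
    by apply: sM sD (sd _ _ (IH i j)) _; lia.
  apply: (sM _ _ d _ _ _ (IH i j)); last by lia.
  apply: (sM _ _ 1%N d); [|exact: sd|lia].
  by rewrite -polyC_natr size_polyC leq_b1.
apply: leq_trans (size_sum _ _ _) _; apply/bigmax_leqP => k _.
by apply: sM (IH i k) (sB k j) _; lia.
Qed.

Lemma numer_comp z Delta B m i j :
  numer (Delta \Po ('X + z%:P)) (map_mx (comp_poly ('X + z%:P)) B) m i j
  = numer Delta B m i j \Po ('X + z%:P).
Proof.
have dc (p : {poly K}) : (p \Po ('X + z%:P))^`() = p^`() \Po ('X + z%:P).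
  by rewrite deriv_comp derivD derivX derivC addr0 mulr1.
elim: m i j => [|m IH] i j.
  by rewrite !mxE mulrb; case: eqP; rewrite ?comp_polyC ?comp_poly0 // -polyC1 comp_polyC.
rewrite !numerS IH !dc raddfD raddfB /= !rmorphM /= rmorph_nat raddf_sum; congr (_ + _).
by apply: eq_bigr => k _; rewrite IH mxE [RHS]comp_polyM.
Qed.

Section FormalSolution.
Variables (Delta : {poly K}) (B : 'M[{poly K}]_n).
Implicit Types y : 'I_n -> {poly K}.

Definition formal_solution M y := forall i,
  eqmodX M (Delta * (y i)^`()) (\sum_j B i j * y j).

Lemma eqmodX_deriv M (p q : {poly K}) : eqmodX M p q -> eqmodX M.-1 p^`() q^`().
Proof. by move=> h k kM; rewrite !coef_deriv h //; lia. Qed.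

(** Differentiating [Delta^m y^(m) = P_m y] and multiplying by [Delta] yields the
    recursion defining [numer]; each derivative loses one order of precision. *)
Lemma formal_solution_derivn M y m i : formal_solution M y ->
  eqmodX (M.+1 - m) (Delta ^+ m * (y i)^`(m)) (\sum_j numer Delta B m i j * y j).
Proof.
move=> yM; elim: m i => [|m IH] i.
  rewrite derivn0 expr0 mul1r (bigD1 i) //= mxE eqxx mul1r big1 ?addr0 // => j ji.
  by rewrite mxE eq_sym (negbTE ji) mul0r.
have IH' := eqmodX_deriv (IH i).
have IH1 : eqmodX (M.+1 - m.+1) (Delta ^+ m * (y i)^`(m)) (\sum_j numer Delta B m i j * y j).
  by apply: eqmodXW (IH i); lia.
have {IH'}IH2 : eqmodX (M.+1 - m.+1) (Delta ^+ m * (y i)^`(m))^`()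
    (\sum_j numer Delta B m i j * y j)^`().
  by apply: eqmodXW IH'; lia.
have E1 : Delta ^+ m.+1 * (y i)^`(m.+1)
    = Delta * (Delta ^+ m * (y i)^`(m))^`() - m%:R * Delta^`() * (Delta ^+ m * (y i)^`(m)).
  rewrite derivM -derivnS deriv_exp -mulr_natl.
  case: m {IH IH1 IH2} => [|m]; first by rewrite expr1 expr0; ring.
  by rewrite !exprS /=; ring.
have E2 : \sum_j numer Delta B m.+1 i j * y j =
    (Delta * (\sum_j numer Delta B m i j * y j)^`()
    - m%:R * Delta^`() * (\sum_j numer Delta B m i j * y j))
    + \sum_j numer Delta B m i j * (\sum_k B j k * y k - Delta * (y j)^`()).
  rewrite raddf_sum !mulr_sumr -sumrB.
  rewrite (eq_bigr (fun j =>
      (Delta * (numer Delta B m i j)^`() - m%:R * Delta^`() * numer Delta B m i j) * y j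
      + \sum_k numer Delta B m i k * B k j * y j)); last first.
    by move=> j _; rewrite numerS mulrDl mulr_suml.
  rewrite big_split /= exchange_big /= -!big_split /=; apply: eq_bigr => j _.
  rewrite derivM mulrBr mulr_sumr.
  under [in RHS]eq_bigr do rewrite mulrA.
  by ring.
rewrite E1 E2 -[X in eqmodX _ X _]addr0; apply: eqmodXD; last first.
  apply: eqmodX_sym; apply: (@eqmodX_trans _ _ _ (\sum_(j < n) 0)); last by rewrite big1_eq.
  apply: eqmodX_sum => j; rewrite -[X in eqmodX _ _ X](mulr0 (numer Delta B m i j)).
  apply: eqmodXM => //; rewrite -[X in eqmodX _ _ X](subrr (Delta * (y j)^`())).
  apply: eqmodXD => //; apply: eqmodX_sym; apply: eqmodXW (yM j); lia.
by apply: eqmodXD; [apply: eqmodXM | apply: eqmodXN; apply: eqmodXM].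
Qed.

Hypothesis Delta0 : Delta`_0 != 0.

(** Adding a term [c 'X^(M.+1)] changes [Delta y' - B y] in order [M] by
    [(M + 1) Delta_0 c], so the defect can be cancelled one order at a time. *)
Lemma formal_solution_exists M (v : 'I_n -> K) :
  exists2 y, formal_solution M y & forall i, (y i)`_0 = v i.
Proof.
elim: M => [|M [y yM y0]]; first by exists (fun i => (v i)%:P) => [i []|i]; rewrite ?coefC.
pose r i := (Delta * (y i)^`() - \sum_j B i j * y j)`_M.
pose c i := - r i / (M.+1%:R * Delta`_0).
exists (fun i => y i + c i *: 'X^(M.+1)); last first.
  by move=> i; rewrite coefD coefZ coefXn mulr0 addr0.
have cX (p : {poly K}) (a : K) l k :
    (p * (a *: 'X^l))`_k = if (k < l)%N then 0 else a * p`_(k - l).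
  by rewrite -scalerAr coefZ coefMXn; case: ifP; rewrite ?mulr0.
move=> i k kM; rewrite derivD derivZ derivXn /= -scaler_nat scalerA mulrDr.
under eq_bigr do rewrite mulrDr.
rewrite big_split /= [in RHS]coefD [X in _ = _ + X]coef_sum [X in _ = _ + X]big1; last first.
  by move=> j _; rewrite cX kM.
rewrite addr0 coefD cX; case: ltnP => Mk; first by rewrite addr0 yM.
have -> : k = M by lia.
apply/eqP; rewrite -subr_eq0 addrAC -coefB -/(r i) subnn /c -[_ * _ * Delta`_0]mulrA divfK.
  by rewrite addrN.
by rewrite mulf_neq0 ?pnatr_eq0.
Qed.

Definition solution_coef (v : 'I_n -> K) (i : 'I_n) (m : nat) : K :=
  (\sum_j (numer Delta B m i j)`_0 * v j) / (m`!%:R * Delta`_0 ^+ m).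

(** By [formal_solution_derivn] evaluated at [0], a formal solution starting with
    [v] has no choice but to have the coefficients [solution_coef v]. *)
Lemma solution_coef_formal M v :
  formal_solution M (fun i => trunc (solution_coef v i) M.+1).
Proof.
have [y yM y0] := formal_solution_exists M v.
have ty i : eqmodX M.+1 (trunc (solution_coef v i) M.+1) (y i).
  move=> m mM; rewrite coef_trunc mM.
  have /(_ 0%N) := formal_solution_derivn (m := m) i yM; rewrite subn_gt0 mM => /(_ isT).
  rewrite coef0M -(horner_coef0 (Delta ^+ m)) horner_exp horner_coef0.
  rewrite coef_derivn addn0 ffactnn coef_sum => E.
  apply: (mulIf (_ : m`!%:R * Delta`_0 ^+ m != 0)).
    by rewrite mulf_neq0 ?expf_neq0 // pnatr_eq0 -lt0n fact_gt0.
  rewrite divfK; last by rewrite mulf_neq0 ?expf_neq0 // pnatr_eq0 -lt0n fact_gt0.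
  rewrite mulrA mulr_natr [RHS]mulrC E; apply: eq_bigr => j _.
  by rewrite coef0M y0.
move=> i; apply: eqmodX_trans (_ : eqmodX M _ (Delta * (y i)^`())) _.
  by apply: eqmodXM => //; apply: (eqmodX_deriv (ty i)).
apply: eqmodX_trans (yM i) _; apply: eqmodX_sum => j; apply: eqmodXM => //.
by apply/eqmodX_sym/(eqmodXW _ (ty j)).
Qed.

End FormalSolution.
End Numerators.

(** * Growth of the coefficients *)

Section WeightedNorm.
Variables (K : numFieldType) (r : K).
Hypothesis r_ge0 : 0 <= r.
Implicit Types p q : {poly K}.

(** A submultiplicative norm that bounds [p] on the disc of radius [r]. *)
Definition wnorm p := \sum_(k < size p) `|p`_k| * r ^+ k.

Lemma wnorm_wide M p : (size p <= M)%N -> wnorm p = \sum_(k < M) `|p`_k| * r ^+ k.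
Proof.
move=> sM; rewrite /wnorm (big_ord_widen_cond _ xpredT (fun k => `|p`_k| * r ^+ k) sM).
rewrite big_mkcond /=; apply: eq_bigr => k _; case: ltnP => // pk.
by rewrite nth_default // normr0 mul0r.
Qed.

Lemma wnorm_ge0 p : 0 <= wnorm p.
Proof. by apply: sumr_ge0 => k _; rewrite mulr_ge0 ?exprn_ge0. Qed.

Lemma wnorm0 : wnorm 0 = 0.
Proof. by rewrite /wnorm size_poly0 big_ord0. Qed.

Lemma wnormD p q : wnorm (p + q) <= wnorm p + wnorm q.
Proof.
pose M := maxn (size p) (size q).
rewrite (@wnorm_wide M (p + q)) ?size_polyD // (@wnorm_wide M p) ?leq_maxl //.
rewrite (@wnorm_wide M q) ?leq_maxr // -big_split /=; apply: ler_sum => k _.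
by rewrite -mulrDl coefD ler_wpM2r ?exprn_ge0 ?ler_normD.
Qed.

Lemma wnormZ a p : wnorm (a *: p) = `|a| * wnorm p.
Proof.
rewrite (@wnorm_wide (size p)) ?size_scale_leq // mulr_sumr.
by apply: eq_bigr => k _; rewrite coefZ normrM mulrA.
Qed.

Lemma wnormN p : wnorm (- p) = wnorm p.
Proof. by rewrite -scaleN1r wnormZ normrN1 mul1r. Qed.

Lemma wnormMX p : wnorm (p * 'X) = wnorm p * r.
Proof.
rewrite (@wnorm_wide (size p).+1); last first.
  by apply: leq_trans (size_polyMleq _ _) _; rewrite size_polyX addn2.
rewrite big_ord_recl coefMX normr0 mul0r add0r mulr_suml.
by apply: eq_bigr => k _; rewrite coefMX /= exprSr mulrA.
Qed.

Lemma wnormMXn p n : wnorm (p * 'X^n) = wnorm p * r ^+ n.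
Proof.
by elim: n => [|n IH]; rewrite ?expr0 ?mulr1 // !exprSr !mulrA wnormMX IH.
Qed.

Lemma wnormC a : wnorm a%:P = `|a|.
Proof.
rewrite (@wnorm_wide 1) ?size_polyC ?leq_b1 //.
by rewrite big_ord1 coefC expr0 mulr1.
Qed.

Lemma wnormM p q : wnorm (p * q) <= wnorm p * wnorm q.
Proof.
elim/poly_ind: p => [|p c IH]; first by rewrite mul0r wnorm0 mul0r.
have -> : wnorm (p * 'X + c%:P) = wnorm p * r + `|c|.
  rewrite (@wnorm_wide (size p).+1); last first.
    rewrite size_MXaddC; case: ifP => //.
  rewrite big_ord_recl coefD coefMX coefC add0r expr0 mulr1 addrC; congr (_ + _).
  rewrite mulr_suml; apply: eq_bigr => k _.
  by rewrite coefD coefMX coefC /= addr0 exprSr mulrA.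
rewrite mulrDl (le_trans (wnormD _ _)) // mulrDl lerD //.
  by rewrite mulrAC wnormMX mulrAC ler_wpM2r.
by rewrite mul_polyC wnormZ.
Qed.

Lemma wnorm_sum (I : Type) (s : seq I) (F : I -> {poly K}) :
  wnorm (\sum_(i <- s) F i) <= \sum_(i <- s) wnorm (F i).
Proof.
elim: s => [|i s IH]; first by rewrite !big_nil wnorm0.
by rewrite !big_cons (le_trans (wnormD _ _)) // lerD.
Qed.

Lemma wnorm_horner p x : `|x| <= r -> `|p.[x]| <= wnorm p.
Proof.
move=> xr; rewrite horner_coef (le_trans (ler_norm_sum _ _ _)) //.
apply: ler_sum => k _; rewrite normrM normrX ler_wpM2l //.
by rewrite lerXn2r ?nnegrE.
Qed.

Lemma wnorm_coef0 p : `|p`_0| <= wnorm p.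
Proof. by rewrite -horner_coef0 wnorm_horner ?normr0. Qed.

Lemma wnorm_trunc (b : nat -> K) M : wnorm (trunc b M) = \sum_(k < M) `|b k| * r ^+ k.
Proof.
rewrite (@wnorm_wide M) ?size_poly //; apply: eq_bigr => k _.
by rewrite coef_trunc ltn_ord.
Qed.

End WeightedNorm.

Lemma wnorm1_deriv (K : numFieldType) (p : {poly K}) :
  wnorm 1 p^`() <= (size p)%:R * wnorm 1 p.
Proof.
have r0 : 0 <= 1 :> K by [].
rewrite (@wnorm_wide _ _ (size p)); last first.
  by have [->|/lt_size_deriv/ltnW//] := eqVneq p 0; rewrite deriv0 size_poly0.
rewrite (@wnorm_wide _ _ (size p).+1) // big_ord_recl mulrDr -[leLHS]add0r lerD //.
  by rewrite mulr_ge0 // mulr_ge0 // exprn_ge0.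
rewrite mulr_sumr; apply: ler_sum => k _; rewrite coef_deriv normrMn !expr1n !mulr1.
by rewrite -[_ *+ k.+1]mulr_natl ler_wpM2r // ler_nat.
Qed.

Section NumeratorBound.
Variables (K : numFieldType) (n : nat) (Delta : {poly K}) (B : 'M[{poly K}]_n).

(** Each step of the recursion multiplies the norm by at most a constant times
    [m + 1], as differentiation costs a factor of the size of the degree. *)
Lemma numer_bound : exists2 H : K, 0 <= H &
  forall m i j, wnorm 1 (numer Delta B m i j) <= H ^+ m * m`!%:R.
Proof.
have r0 : 0 <= 1 :> K by [].
have [d sN] := size_numer Delta B.
pose bB := \sum_i \sum_j wnorm 1 (B i j).
have bBE i j : wnorm 1 (B i j) <= bB.
  rewrite /bB (bigD1 i) //= (bigD1 j) //= -addrA lerDl addr_ge0 ?sumr_ge0 // => k _.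
    exact: wnorm_ge0.
  by rewrite sumr_ge0 // => l _; apply: wnorm_ge0.
have bB0 : 0 <= bB by rewrite sumr_ge0 // => k _; rewrite sumr_ge0 // => l _; apply: wnorm_ge0.
pose H := wnorm 1 Delta * d.+1%:R + wnorm 1 Delta^`() + n%:R * bB.
have H0 : 0 <= H by rewrite !addr_ge0 ?mulr_ge0 ?wnorm_ge0.
exists H => //; elim=> [|m IH] i j.
  rewrite mxE expr0 mulr1 mulrb; case: eqP; rewrite ?wnorm0 // => _.
  by rewrite -polyC1 wnormC normr1.
set X := H ^+ m * m`!%:R.
have X0 : 0 <= X by rewrite mulr_ge0 ?exprn_ge0.
have -> : H ^+ m.+1 * (m.+1)`!%:R = m.+1%:R * H * X.
  by rewrite factS natrM exprS /X; ring.
have E : m.+1%:R * H * X = wnorm 1 Delta * ((m.+1 * d.+1)%:R * X)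
   + m.+1%:R * (wnorm 1 Delta^`() * X) + m.+1%:R * (n%:R * (X * bB)).
  by rewrite natrM /H; ring.
rewrite E numerS (le_trans (wnormD r0 _ _)) // lerD //.
  rewrite (le_trans (wnormD r0 _ _)) // wnormN lerD //.
    rewrite (le_trans (wnormM r0 _ _)) // ler_wpM2l ?wnorm_ge0 //.
    rewrite (le_trans (wnorm1_deriv _)) // ler_pM ?wnorm_ge0 // ler_nat.
    by apply: leq_trans (sN m i j) _; nia.
  rewrite -mulrA mulr_natl -scaler_nat wnormZ normr_nat ler_pM ?wnorm_ge0 ?ler_nat //.
  by rewrite (le_trans (wnormM r0 _ _)) // ler_wpM2l ?wnorm_ge0.
rewrite (le_trans (wnorm_sum _ _ _)) //.
rewrite (@le_trans _ _ (n%:R * (X * bB))) //; last first.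
  by apply: ler_peMl; rewrite ?ler1n //; apply: mulr_ge0 => //; apply: mulr_ge0.
rewrite (@le_trans _ _ (\sum_(k < n) X * bB)) //; last by rewrite sumr_const card_ord mulr_natl.
apply: ler_sum => k _; rewrite (le_trans (wnormM r0 _ _)) //.
by rewrite ler_pM ?wnorm_ge0.
Qed.

Lemma solution_coef_bound : Delta`_0 != 0 -> exists2 rho : K, 0 < rho &
  forall v, exists2 C, 0 <= C & forall i m, `|solution_coef Delta B v i m| <= C * rho ^+ m.
Proof.
move=> D0; have [H H0 HB] := numer_bound.
have D0' : 0 < `|Delta`_0| by rewrite normr_gt0.
exists ((H + 1) / `|Delta`_0|); first by rewrite divr_gt0 // ltr_wpDl.
move=> v; exists (\sum_j `|v j|); first by rewrite sumr_ge0.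
move=> i m; rewrite /solution_coef normrM normfV normrM normrX normr_nat.
have f0 : 0 < m`!%:R :> K by rewrite ltr0n fact_gt0.
rewrite ler_pdivrMr ?mulr_gt0 ?exprn_gt0 // expr_div_n.
have -> : (\sum_j `|v j|) * ((H + 1) ^+ m / `|Delta`_0| ^+ m) * (m`!%:R * `|Delta`_0| ^+ m)
   = \sum_j ((H + 1) ^+ m * m`!%:R * `|v j|).
  rewrite -mulr_sumr; field.
  by rewrite expf_neq0 // gt_eqF.
rewrite (le_trans (ler_norm_sum _ _ _)) // ler_sum // => j _; rewrite normrM ler_wpM2r //.
rewrite (le_trans (wnorm_coef0 ler01 _)) // (le_trans (HB m i j)) // ler_wpM2r ?(ltW f0) //.
by rewrite lerXn2r ?nnegrE ?addr_ge0 // lerDl.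
Qed.

End NumeratorBound.

(** * Sums of power series *)

(** The two facts about the complex numbers that convergence arguments need.
    They are kept as properties of an abstract field, because unfolding the
    concrete operations on pairs of reals would only hamper the computations. *)
Definition geometric_complete (K : numFieldType) := forall (u : nat -> K) C q,
  0 <= C -> 0 <= q -> q <= 2^-1 -> (forall m, `|u m| <= C * q ^+ m) ->
  exists l, forall M, `|\sum_(m < M) u m - l| <= 4 * C * q ^+ M.

Definition geometric_archimedean (K : numFieldType) := forall a b C q : K,
  0 <= C -> 0 <= q -> q <= 2^-1 -> (forall M, a <= b + C * q ^+ M) -> a <= b.

Section PowerSeries.
Variable K : numFieldType.
Implicit Types (x h s : K) (b : nat -> K).

(** The remainders [e_m] of the first-order expansion satisfy
    [e_(m+1) = (x + h) e_m + m h^2 x^(m-1)]. *)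
Lemma taylor_monomial s x h m : 0 <= s -> `|x| <= s -> `|h| <= s ->
  `|(x + h) ^+ m - x ^+ m - h * (x ^+ m.-1 *+ m)| * s ^+ 2 <= `|h| ^+ 2 * (4 * s) ^+ m.
Proof.
move=> s0 xs hs; elim: m => [|m IH].
  by rewrite !expr0 subrr mulr0n mulr0 subrr normr0 mul0r mulr1 exprn_ge0.
set e := (X in `|X|) in IH.
have -> : (x + h) ^+ m.+1 - x ^+ m.+1 - h * (x ^+ m.+1.-1 *+ m.+1)
   = (x + h) * e + h ^+ 2 * (x ^+ m.-1 *+ m).
  rewrite /e {IH e}; case: m => [|m] /=; first by rewrite !expr0 !expr1 mulr0n mulr1n; ring.
  rewrite (exprS (x + h) m.+1) (exprS x m.+1) (exprS x m) (mulrS _ m.+1).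
  rewrite -(mulr_natl (x ^+ m) m.+1) -(mulr_natl (x * x ^+ m) m.+1).
  by move: ((x + h) ^+ m.+1) (x ^+ m) (m.+1%:R) => y z t; ring.
have hx : `|x + h| <= 2 * s.
  by rewrite mulr_natl mulr2n (le_trans (ler_normD _ _)) // lerD.
have m4 : m%:R <= 4 ^+ m :> K.
  by rewrite -natrX ler_nat ltnW // ltn_expl.
rewrite (@le_trans _ _ ((2 * s) * (`|h| ^+ 2 * (4 * s) ^+ m)
    + `|h| ^+ 2 * (4 ^+ m * s ^+ m.+1))) //.
  rewrite (le_trans (ler_wpM2r _ (ler_normD _ _))) ?exprn_ge0 // mulrDl lerD //.
    by rewrite normrM -mulrA ler_pM ?mulr_ge0 ?exprn_ge0.
  rewrite normrM normrX -mulrA ler_wpM2l ?exprn_ge0 // -[_ *+ m]mulr_natl normrM normr_nat normrX.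
  case: m {IH e} m4 => [|m] m4; first by rewrite !mul0r mulr_ge0 ?exprn_ge0.
  rewrite -mulrA /= ler_pM ?mulr_ge0 ?exprn_ge0 //.
  by rewrite -[m.+2]addn2 exprD ler_wpM2r ?exprn_ge0 // lerXn2r ?nnegrE.
have -> : 2 * s * (`|h| ^+ 2 * (4 * s) ^+ m) + `|h| ^+ 2 * (4 ^+ m * s ^+ m.+1)
   = `|h| ^+ 2 * (3 * (4 ^+ m * s ^+ m.+1)).
  by rewrite exprMn (exprS s m); ring.
rewrite ler_wpM2l ?exprn_ge0 // exprMn (exprS 4 m) -mulrA.
by rewrite ler_wpM2r ?mulr_ge0 ?exprn_ge0 // ler_nat.
Qed.

Lemma sum_half M : \sum_(m < M) (2^-1) ^+ m <= 2 :> K.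
Proof.
have -> : \sum_(m < M) (2^-1) ^+ m = 2 - 2 * (2^-1) ^+ M :> K.
  elim: M => [|M IH]; first by rewrite big_ord0 expr0 mulr1 subrr.
  rewrite big_ord_recr IH /= [in RHS]exprS mulrA divff ?pnatr_eq0 // mul1r.
  ring.
by rewrite gerBl mulr_ge0 // exprn_ge0 // invr_ge0.
Qed.


Lemma horner_trunc b M x : (trunc b M).[x] = \sum_(m < M) b m * x ^+ m.
Proof. exact: horner_poly. Qed.

Definition dcoef b m := m.+1%:R * b m.+1.

Lemma deriv_trunc b M : (trunc b M.+1)^`() = trunc (dcoef b) M.
Proof.
apply/polyP => k; rewrite coef_deriv !coef_trunc ltnS /dcoef.
by case: ifP; rewrite ?mul0rn // mulr_natl.
Qed.

Lemma dcoef_bound b C rho : 0 <= C -> 0 <= rho ->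
  (forall m, `|b m| <= C * rho ^+ m) ->
  forall m, `|dcoef b m| <= C * rho * (2 * rho) ^+ m.
Proof.
move=> C0 r0 bC m; rewrite normrM normr_nat exprMn.
apply: (@le_trans _ _ (2 ^+ m * (C * rho ^+ m.+1))).
  by apply: ler_pM => //; rewrite -natrX ler_nat ltn_expl.
by rewrite (exprS rho m) le_eqVlt; apply/orP; left; apply/eqP; ring.
Qed.

Lemma taylor_trunc b C rho M x h : 0 <= C -> 0 < rho ->
  (forall m, `|b m| <= C * rho ^+ m) ->
  let s := (8 * rho)^-1 in `|x| <= s -> `|h| <= s ->
  `|(trunc b M.+1).[x + h] - (trunc b M.+1).[x] - h * (trunc (dcoef b) M).[x]|
    <= 2 * C / s ^+ 2 * `|h| ^+ 2.
Proof.
move=> C0 r0 bC s xs hs; have s0 : 0 < s by rewrite invr_gt0 mulr_gt0.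
rewrite -deriv_trunc /trunc poly_def raddf_sum /= !horner_sum mulr_sumr -!sumrB.
rewrite mulrAC ler_pdivlMr ?exprn_gt0 //.
rewrite (@le_trans _ _ (\sum_(m < M.+1) C * `|h| ^+ 2 * 2^-1 ^+ m)) //.
  rewrite (le_trans (ler_wpM2r _ (ler_norm_sum _ _ _))) ?exprn_ge0 ?(ltW s0) //.
  rewrite mulr_suml.
  apply: ler_sum => m _; rewrite derivZ derivXn !hornerZ hornerMn !hornerXn.
  rewrite (_ : _ - _ = b m * ((x + h) ^+ m - x ^+ m - h * (x ^+ m.-1 *+ m))); last by ring.
  rewrite normrM -mulrA (le_trans (ler_wpM2l _ (taylor_monomial _ (ltW s0) xs hs))) //.
  rewrite (le_trans (ler_wpM2r _ (bC m))) ?mulr_ge0 ?exprn_ge0 ?mulr_ge0 ?(ltW r0) ?(ltW s0) //.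
  have -> : 2^-1 = rho * (4 * s) :> K.
    by rewrite /s; field; rewrite gt_eqF.
  rewrite (exprMn m rho) le_eqVlt; apply/orP; left; apply/eqP.
  by move: ((4 * s) ^+ m) => z; ring.
rewrite -mulr_sumr -[leRHS]mulrA [leRHS]mulrC.
by rewrite ler_wpM2l ?mulr_ge0 ?exprn_ge0 ?sum_half.
Qed.

Hypotheses (Kc : geometric_complete K) (Kl : geometric_archimedean K).

(** [f] is the sum on the disc of radius [4 s] of the series with coefficients
    [b], when these are bounded by [C rho^m], and [g] is its derivative on the
    disc of radius [s].  The radius is an eighth of the guaranteed radius of
    convergence [1 / rho]; this leaves room for [x + h] and makes all ratios at
    most [1/2]. *)
Definition sums_to b C rho (f g : K -> K) := let s := (8 * rho)^-1 in [/\
  forall x, `|x| <= 4 * s -> forall M,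
    `|(trunc b M).[x] - f x| <= 4 * C * (rho * `|x|) ^+ M,
  forall x, `|x| <= s -> forall M,
    `|(trunc (dcoef b) M).[x] - g x| <= 4 * (C * rho) * (2 * rho * `|x|) ^+ M &
  forall x h, `|x| <= s -> `|h| <= s ->
    `|f (x + h) - f x - h * g x| <= 2 * C / s ^+ 2 * `|h| ^+ 2 ].

(** The Taylor estimate holds for all truncations with the same constant
    ([taylor_trunc]), so it passes to the limit. *)
Lemma power_series_sum b C rho : 0 <= C -> 0 < rho ->
  (forall m, `|b m| <= C * rho ^+ m) -> exists f g, sums_to b C rho f g.
Proof.
move=> C0 r0 bC; pose s := (8 * rho)^-1; have s0 : 0 < s by rewrite invr_gt0 mulr_gt0.
have sr : rho * s = 8^-1 by rewrite /s; field; rewrite gt_eqF.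
have half x : `|x| <= 4 * s -> rho * `|x| <= 2^-1.
  move=> xs; rewrite (@le_trans _ _ (rho * (4 * s))) ?ler_wpM2l ?(ltW r0) ?(ltW s0) //.
  by rewrite mulrCA sr; have -> : 4 * 8^-1 = 2^-1 :> K by field.
have [f fP] : exists f, forall x, `|x| <= 4 * s -> forall M,
    `|(trunc b M).[x] - f x| <= 4 * C * (rho * `|x|) ^+ M.
  suff /choice : forall x, exists l, `|x| <= 4 * s -> forall M,
    `|(trunc b M).[x] - l| <= 4 * C * (rho * `|x|) ^+ M by case=> f; exists f.
  move=> x; have [xs|] := pselect (`|x| <= 4 * s); last by move=> nx; exists 0 => /nx.
  have [|m|l lP] := Kc (u := fun m => b m * x ^+ m) C0 _ (half x xs).
  - by rewrite mulr_ge0 ?(ltW r0) ?(ltW s0).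
  - by rewrite normrM normrX exprMn mulrA ler_wpM2r ?exprn_ge0.
  - by exists l => _ M; rewrite horner_trunc.
have dC := dcoef_bound C0 (ltW r0) bC.
have half' x : `|x| <= s -> 2 * rho * `|x| <= 2^-1.
  move=> xs; rewrite -mulrA (@le_trans _ _ (2 * (rho * s))) ?ler_wpM2l ?(ltW r0) ?(ltW s0) //.
  by rewrite sr (_ : 2 * 8^-1 = 4^-1) ?lef_pV2 ?posrE ?ler_nat //; field.
have [g gP] : exists g, forall x, `|x| <= s -> forall M,
    `|(trunc (dcoef b) M).[x] - g x| <= 4 * (C * rho) * (2 * rho * `|x|) ^+ M.
  suff /choice : forall x, exists l, `|x| <= s -> forall M,
    `|(trunc (dcoef b) M).[x] - l| <= 4 * (C * rho) * (2 * rho * `|x|) ^+ M by case=> g; exists g.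
  move=> x; have [xs|] := pselect (`|x| <= s); last by move=> nx; exists 0 => /nx.
  have [||m|l lP]  := Kc (u := fun m => dcoef b m * x ^+ m) (C := C * rho) _ _ (half' x xs).
  - by rewrite mulr_ge0 ?(ltW r0) ?(ltW s0).
  - by rewrite !mulr_ge0 ?(ltW r0) ?(ltW s0).
  - by rewrite normrM normrX (exprMn _ _ `|x|) mulrA ler_wpM2r ?exprn_ge0.
  - by exists l => _ M; rewrite horner_trunc.
exists f, g; rewrite /sums_to -/s; split=> // x h xs hs.
have x4 : `|x| <= 4 * s.
  by apply: (le_trans xs); apply: ler_peMl; rewrite ?(ltW s0) ?ler1n.
have xh4 : `|x + h| <= 4 * s.
  rewrite (le_trans (ler_normD _ _)) // (le_trans (lerD xs hs)) // -mulr2n -(mulr_natl s 2).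
  by rewrite ler_wpM2r ?(ltW r0) ?(ltW s0) // ler_nat.
apply: (Kl (C := 4 * C + 4 * C + s * (4 * (C * rho))) (q := 2^-1)) => //.
- by rewrite !addr_ge0 // !mulr_ge0 ?(ltW r0) ?(ltW s0).
- by rewrite invr_ge0.
move=> M.
have bnd (y c q : K) : 0 <= c -> 0 <= q -> q <= 2^-1 -> y <= c * q ^+ M -> y <= c * 2^-1 ^+ M.
  by move=> c0 q0 q2 yc; rewrite (le_trans yc) // ler_wpM2l // lerXn2r // nnegrE invr_ge0.
have bnd1 (y c q : K) : 0 <= c -> 0 <= q -> q <= 2^-1 -> y <= c * q ^+ M.+1 -> y <= c * 2^-1 ^+ M.
  move=> c0 q0 q2 yc; apply: (bnd y c q c0 q0 q2); rewrite (le_trans yc) // ler_wpM2l // exprS.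
  by rewrite ler_piMl ?exprn_ge0 // (le_trans q2) // invf_le1 // ler1n.
have f1 := bnd1 _ _ _ _ _ (half _ xh4) (fP _ xh4 M.+1).
have f2 := bnd1 _ _ _ _ _ (half _ x4) (fP _ x4 M.+1).
have g1 := bnd _ _ _ _ _ (half' _ xs) (gP _ xs M).
have C4 : 0 <= 4 * C by rewrite mulr_ge0.
have {}f1 := f1 C4 (mulr_ge0 (ltW r0) (normr_ge0 _)).
have {}f2 := f2 C4 (mulr_ge0 (ltW r0) (normr_ge0 _)).
have {}g1 : `|(trunc (dcoef b) M).[x] - g x| <= 4 * (C * rho) * 2^-1 ^+ M.
  by apply: g1; rewrite !mulr_ge0 ?(ltW r0) ?(ltW s0).
have tb := taylor_trunc M C0 r0 bC xs hs.
set T := trunc b M.+1 in f1 f2 tb; set T' := trunc _ M in g1 tb.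
have -> : f (x + h) - f x - h * g x = (T.[x + h] - T.[x] - h * T'.[x])
   - (T.[x + h] - f (x + h)) + (T.[x] - f x) + h * (T'.[x] - g x) by ring.
have E (u v w q : K) : u + (v + v + w) * q = u + v * q + v * q + w * q by ring.
rewrite E (le_trans (ler_normD _ _)) // lerD //; last first.
  by rewrite normrM -mulrA ler_pM.
rewrite (le_trans (ler_normD _ _)) // lerD // (le_trans (ler_normD _ _)) // lerD //.
by rewrite normrN.
Qed.

End PowerSeries.

(** * From formal identities to the sums, and back *)

Section Limits.
Variable K : numFieldType.
Hypothesis Kl : geometric_archimedean K.
Implicit Types (x : K) (b : nat -> K) (p : {poly K}) (P : {poly {poly K}}).

Lemma half_ge0 : 0 <= 2^-1 :> K. Proof. by rewrite invr_ge0. Qed.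

Lemma small_eq0 a C : 0 <= C -> (forall M, `|a| <= C * 2^-1 ^+ M) -> a = 0 :> K.
Proof.
move=> C0 aC; apply/eqP; rewrite -normr_le0.
by apply: (Kl C0 half_ge0) => // M; rewrite add0r.
Qed.

Lemma horner_eqmodX0 s M p x : 0 < s -> eqmodX M p 0 -> `|x| <= s ->
  `|p.[x]| <= wnorm (2 * s) p * 2^-1 ^+ M.
Proof.
move=> s0 /eqmodX_Xn0 pE xs; have s2 : 0 <= 2 * s by rewrite mulr_ge0 ?ltW.
have xs2 : `|x| <= 2 * s by rewrite (le_trans xs) // ler_peMl ?(ltW s0) ?ler1n.
rewrite pE hornerM hornerXn [X in wnorm _ X]mulrC wnormMXn // normrM normrX -mulrA -exprMn.
rewrite (_ : 2 * s * 2^-1 = s); last by field.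
by rewrite mulrC ler_pM ?exprn_ge0 ?wnorm_horner // lerXn2r ?nnegrE ?(ltW s0).
Qed.

Lemma wnorm_trunc_le r rho C b M : 0 <= r -> 0 <= rho -> 0 <= C -> rho * r <= 2^-1 ->
  (forall m, `|b m| <= C * rho ^+ m) -> wnorm r (trunc b M) <= 2 * C.
Proof.
move=> r0 rho0 C0 rr bC; rewrite wnorm_trunc //.
rewrite (@le_trans _ _ (\sum_(k < M) C * 2^-1 ^+ k)) //.
  apply: ler_sum => k _; rewrite (le_trans (ler_wpM2r _ (bC k))) ?exprn_ge0 //.
  by rewrite -mulrA -exprMn ler_wpM2l // lerXn2r ?nnegrE ?mulr_ge0 ?half_ge0.
by rewrite -mulr_sumr [leRHS]mulrC ler_wpM2l ?sum_half.
Qed.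

(** The defect [Delta T' - B T] of a truncation [T] of order [M] is divisible by
    ['X^M] and its norm on the disc of radius [2 s] is bounded uniformly in [M];
    on the disc of radius [s] it therefore tends to zero like [2^-M]. *)
Lemma formal_solution_sum n Delta (B : 'M[{poly K}]_n) (b : 'I_n -> nat -> K)
    (C rho c x : K) (f g : 'I_n -> K) :
  0 <= C -> 0 < rho -> (forall i m, `|b i m| <= C * rho ^+ m) ->
  (forall M, formal_solution Delta B M (fun i => trunc (b i) M.+1)) ->
  `|x| <= (8 * rho)^-1 -> 0 <= c ->
  (forall i M, `|(trunc (b i) M).[x] - f i| <= c * 2^-1 ^+ M) ->
  (forall i M, `|(trunc (dcoef (b i)) M).[x] - g i| <= c * 2^-1 ^+ M) ->
  forall i, Delta.[x] * g i = \sum_j (B i j).[x] * f j.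
Proof.
move=> C0 r0 bC bS; set s := (8 * rho)^-1 => xs c0 fP gP i.
have s0 : 0 < s by rewrite invr_gt0 mulr_gt0.
have s2 : 0 <= 2 * s by rewrite mulr_ge0 ?ltW.
have sr : rho * s = 8^-1 by rewrite /s; field; rewrite gt_eqF.
pose W := wnorm (2 * s).
have le4 : 4^-1 <= 2^-1 :> K by rewrite lef_pV2 ?posrE ?ler_nat.
have bW j M : W (trunc (b j) M) <= 2 * C.
  apply: (wnorm_trunc_le (rho := rho)) => //; first exact: ltW.
  by rewrite mulrCA sr (_ : 2 * 8^-1 = 4^-1) //; field.
have dW j M : W (trunc (dcoef (b j)) M) <= 2 * (C * rho).
  apply: (@wnorm_trunc_le _ (2 * rho)) => //; rewrite ?mulr_ge0 ?(ltW r0) //.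
    by rewrite mulrACA sr (_ : 2 * 2 * 8^-1 = 2^-1) //; field.
  by apply: dcoef_bound => //; exact: ltW.
pose D := W Delta * (2 * (C * rho)) + \sum_j W (B i j) * (2 * C)
  + (`|Delta.[x]| * c + \sum_j `|(B i j).[x]| * c).
have W0 p : 0 <= W p by apply: wnorm_ge0.
have D0 : 0 <= D.
  have ? := ltW r0; have C2 : 0 <= 2 * C by rewrite mulr_ge0.
  have Cr : 0 <= 2 * (C * rho) by rewrite !mulr_ge0.
  apply: addr_ge0; apply: addr_ge0; rewrite ?mulr_ge0 //; apply: sumr_ge0 => j _; exact: mulr_ge0.
apply/eqP; rewrite -subr_eq0; apply/eqP; apply: (small_eq0 D0) => M.
pose q := Delta * (trunc (dcoef (b i)) M) - \sum_j B i j * trunc (b j) M.+1.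
have q0 : eqmodX M q 0.
  rewrite -(subrr (\sum_j B i j * trunc (b j) M.+1)); apply: eqmodXD => //.
  by rewrite -deriv_trunc; apply: bS.
have qx := horner_eqmodX0 s0 q0 xs.
have qW : W q <= W Delta * (2 * (C * rho)) + \sum_j W (B i j) * (2 * C).
  rewrite (le_trans (wnormD s2 _ _)) // wnormN // lerD //.
    by rewrite (le_trans (wnormM s2 _ _)) // ler_wpM2l.
  rewrite (le_trans (wnorm_sum s2 _ _)) // ler_sum // => j _.
  by rewrite (le_trans (wnormM s2 _ _)) // ler_wpM2l.
have -> : Delta.[x] * g i - \sum_j (B i j).[x] * f j =
    q.[x] - (Delta.[x] * ((trunc (dcoef (b i)) M).[x] - g i)
    + \sum_j (B i j).[x] * (f j - (trunc (b j) M.+1).[x])).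
  rewrite /q hornerD hornerN hornerM horner_sum.
  under [in RHS]eq_bigr do rewrite hornerM.
  under [X in _ - (_ + X)]eq_bigr do rewrite mulrBr.
  by rewrite sumrB; ring.
rewrite /D mulrDl (le_trans (ler_normB _ _)) // lerD //.
  by rewrite (le_trans qx) // ler_wpM2r // exprn_ge0 ?half_ge0.
rewrite (le_trans (ler_normD _ _)) // mulrDl lerD //.
  by rewrite normrM -mulrA ler_wpM2l.
rewrite (le_trans (ler_norm_sum _ _ _)) // mulr_suml ler_sum // => j _.
rewrite normrM -mulrA ler_wpM2l // distrC (le_trans (fP j M.+1)) // ler_wpM2l //.
by rewrite exprS ler_piMl ?exprn_ge0 ?half_ge0 // invf_le1 // ler1n.
Qed.

(** The hypothesis leaves out [x = 0], so that it survives the cancellation of a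
    factor ['X] in the induction; the value at [0] is recovered along the sequence
    [s / 2^k]. *)
Lemma eqmodX_of_small M p c s : 0 < s -> 0 <= c ->
  (forall x, x != 0 -> `|x| <= s -> `|p.[x]| <= c * `|x| ^+ M) -> eqmodX M p 0.
Proof.
move=> s0 c0; elim: M p => [|M IH] p pc; first by [].
pose q := drop_poly 1 (p - (p`_0)%:P).
have pE : p = 'X * q + (p`_0)%:P.
  by rewrite /q -coef0_mulX ?subrK // coefB coefC subrr.
have p0 : p`_0 = 0.
  apply: (small_eq0 (C := s * (c * s ^+ M + wnorm s q))).
    by rewrite mulr_ge0 ?addr_ge0 ?mulr_ge0 ?exprn_ge0 ?wnorm_ge0 ?(ltW s0).
  move=> k; pose x := s * 2^-1 ^+ k.
  have x0 : 0 < x by rewrite mulr_gt0 ?exprn_gt0 ?invr_gt0.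
  have nx : `|x| = x by rewrite ger0_norm ?ltW.
  have xs : `|x| <= s.
    by rewrite nx ler_piMr ?(ltW s0) // exprn_ile1 ?half_ge0 // invf_le1 ?ler1n.
  have -> : p`_0 = p.[x] - x * q.[x] by rewrite {2}pE !hornerE; ring.
  rewrite [leRHS]mulrAC -/x [leRHS]mulrDr (le_trans (ler_normB _ _)) // lerD //.
    rewrite (le_trans (pc x _ xs)) ?gt_eqF // nx exprS mulrCA ler_wpM2l ?(ltW x0) //.
    by rewrite ler_wpM2l // lerXn2r ?nnegrE ?(ltW s0) ?(ltW x0) // -nx.
  by rewrite normrM nx ler_wpM2l ?(ltW x0) // wnorm_horner ?(ltW s0).
rewrite p0 addr0 in pE; rewrite pE -(expr1 'X) -[X in eqmodX _ _ X](mulr0 'X^1).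
apply/(eqmodX_Xn 1); apply: IH => x x0 xs.
have := pc x x0 xs; rewrite pE hornerM hornerX normrM exprS mulrCA.
by rewrite ler_pM2l ?normr_gt0.
Qed.

Lemma horner_horner P p x : P.[p].[x] = P.[(p.[x])%:P].[x].
Proof.
elim/poly_ind: P => [|P q IH]; first by rewrite !horner0.
by rewrite !hornerMXaddC !hornerD !hornerM IH hornerC.
Qed.

Lemma horner_horner_lipschitz P s Y : 0 <= s -> 0 <= Y ->
  exists c d, [/\ 0 <= c, 0 <= d,
    forall x y, `|x| <= s -> `|y| <= Y -> `|P.[y%:P].[x]| <= d &
    forall x y z, `|x| <= s -> `|y| <= Y -> `|z| <= Y ->
      `|P.[y%:P].[x] - P.[z%:P].[x]| <= c * `|y - z|].
Proof.
move=> s0 Y0; elim/poly_ind: P => [|P p [c [d [c0 d0 Pd Pc]]]].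
  exists 0, 0; split=> // [x y _ _|x y z _ _ _]; first by rewrite !horner0 normr0.
  by rewrite !horner0 subrr normr0 mul0r.
exists (c * Y + d), (d * Y + wnorm s p); split.
- by rewrite addr_ge0 ?mulr_ge0.
- by rewrite addr_ge0 ?mulr_ge0 ?wnorm_ge0.
- move=> x y xs yY; rewrite hornerMXaddC hornerD hornerM hornerC.
  rewrite (le_trans (ler_normD _ _)) // lerD ?wnorm_horner // normrM.
  by rewrite ler_pM ?Pd.
- move=> x y z xs yY zY; rewrite !hornerMXaddC !hornerD !hornerM !hornerC.
  set Py := P.[_].[_]; set Pz := P.[_].[_].
  have -> : Py * y + p.[x] - (Pz * z + p.[x]) = (Py - Pz) * y + Pz * (y - z) by ring.
  rewrite [leRHS]mulrDl (le_trans (ler_normD _ _)) // lerD // normrM.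
    by rewrite mulrAC ler_pM ?Pc.
  by rewrite ler_wpM2r ?Pd.
Qed.

(** A truncation of order [M] differs from [f] by [O(|x|^M)], hence so does the
    value of [P] on it from [P(x, f x) = 0]. *)
Lemma series_root_of_vanishing P b C rho s (f : K -> K) : 0 < s -> 0 <= C -> 0 <= rho ->
  (forall x, `|x| <= s -> forall M, `|(trunc b M).[x] - f x| <= C * (rho * `|x|) ^+ M) ->
  (forall x, `|x| <= s -> P.[(f x)%:P].[x] = 0) -> series_root P b.
Proof.
move=> s0 C0 r0 fP Pf M; pose T := trunc b M.
have [||c [_ [c0 _ _ Pc]]] := @horner_horner_lipschitz P s (wnorm s T + C).
- exact: ltW.
- by rewrite addr_ge0 ?wnorm_ge0 ?(ltW s0).
apply: (eqmodX_of_small (c := c * (C * rho ^+ M)) s0).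
  by rewrite !mulr_ge0 ?exprn_ge0.
move=> x _ xs; rewrite horner_horner -[X in `|X|]subr0 -[X in _ - X](Pf x xs).
have TY : `|T.[x]| <= wnorm s T + C.
  by rewrite (le_trans (wnorm_horner (ltW s0) _ xs)) // lerDl.
have fY : `|f x| <= wnorm s T + C.
  have := fP x xs 0%N; rewrite horner_trunc big_ord0 sub0r normrN expr0 mulr1 => fC.
  by rewrite (le_trans fC) // lerDr wnorm_ge0 ?(ltW s0).
rewrite (le_trans (Pc _ _ _ xs TY fY)) // -mulrA ler_wpM2l // (le_trans (fP x xs M)) //.
by rewrite exprMn mulrA.
Qed.

End Limits.

(** * The complex numbers *)

Section Complex.
Variable R : realType.
Local Open Scope complex_scope.

Lemma real_geometric_tail (u : nat -> R) C q M k : 0 <= C -> 0 <= q -> q <= 2^-1 ->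
  (forall m, `|u m| <= C * q ^+ m) ->
  `|\sum_(m < M + k) u m - \sum_(m < M) u m| <= 2 * C * q ^+ M - 2 * C * q ^+ (M + k).
Proof.
move=> C0 q0 q2 uC; elim: k => [|k IH]; first by rewrite addn0 !subrr normr0.
rewrite addnS big_ord_recr /= addrAC (le_trans (ler_normD _ _)) //.
have z0 : 0 <= C * q ^+ (M + k) by rewrite mulr_ge0 ?exprn_ge0.
have := uC (M + k)%N; rewrite exprS.
move: IH z0; rewrite -!(mulrA 2 C) (mulrCA C q).
by move: (C * _) (C * _) => y z; nra.
Qed.

Lemma real_geometric_complete (u : nat -> R) C q : 0 <= C -> 0 <= q -> q <= 2^-1 ->
  (forall m, `|u m| <= C * q ^+ m) ->
  exists l, forall M, `|\sum_(m < M) u m - l| <= 2 * C * q ^+ M.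
Proof.
move=> C0 q0 q2 uC.
have cu : cvgn (series u).
  apply: normed_cvg; apply: (@series_le_cvg _ _ (geometric C q)) => [m|m|m|] /=.
  - exact: normr_ge0.
  - by rewrite mulr_ge0 ?exprn_ge0.
  - exact: uC.
  - apply: is_cvg_geometric_series; rewrite ger0_norm //; lra.
exists (limn (series u)) => M; apply/ler_addgt0Pr => e e0.
have /cvgrPdist_le/(_ _ e0) [N _ Nl] := cu.
have := Nl (M + N)%N (leq_addl _ _); rewrite /series /= big_mkord => lN.
have tail := real_geometric_tail M N C0 q0 q2 uC.
have z0 : 0 <= 2 * C * q ^+ (M + N) by rewrite !mulr_ge0 ?exprn_ge0.
rewrite distrC in tail.
rewrite -(subrKA (\sum_(m < M + N) u m)) (le_trans (ler_normD _ _)) //.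
rewrite lerD //; last by rewrite distrC.
by rewrite (le_trans tail) // gerBl.
Qed.

Lemma norm_imag : `|'i%C| = 1 :> R[i].
Proof. by rewrite normc_def /= expr0n expr1n add0r sqrtr1. Qed.

Lemma complex_geometric_complete : geometric_complete R[i].
Proof.
move=> u C q C0 q0 q2 uC.
have CE : C = (complex.Re C)%:C by rewrite RRe_real ?ger0_real.
have qE : q = (complex.Re q)%:C by rewrite RRe_real ?ger0_real.
rewrite CE qE in C0 q0 q2 uC *; move: (complex.Re C) (complex.Re q) C0 q0 q2 uC => {CE qE}c {}q.
rewrite !ler0c => c0 q0 q2 uC.
have {}q2 : q <= 2^-1.
  by rewrite -lecR (le_trans q2) // fmorphV rmorph_nat.
have bE m : c%:C * q%:C ^+ m = (c * q ^+ m)%:C :> R[i] by rewrite rmorphM rmorphXn.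
have reC m : `|complex.Re (u m)| <= c * q ^+ m.
  by rewrite -lecR (le_trans (normc_ge_Re _)) // -bE.
have imC m : `|complex.Im (u m)| <= c * q ^+ m.
  rewrite -lecR -bE (le_trans _ (uC m)) //.
  by have := normc_ge_Re (u m * 'i%C); rewrite ReiNIm normrN normrM norm_imag mulr1.
have [l lP] := real_geometric_complete c0 q0 q2 reC.
have [k kP] := real_geometric_complete c0 q0 q2 imC.
exists (Complex l k) => M.
have sE : \sum_(m < M) u m =
    Complex (\sum_(m < M) complex.Re (u m)) (\sum_(m < M) complex.Im (u m)).
  elim: M => [|M IH]; first by rewrite !big_ord0.
  by rewrite !big_ord_recr /= IH; case: (u M).
have -> : \sum_(m < M) u m - Complex l k =
    (\sum_(m < M) complex.Re (u m) - l)%:C + 'i%C * (\sum_(m < M) complex.Im (u m) - k)%:C.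
  rewrite sE; apply/eqP; rewrite eq_complex /=.
  by rewrite !(mul0r, mul1r, mulr0, subr0, add0r, addr0) !eqxx.
rewrite (le_trans (ler_normD _ _)) // normrM norm_imag mul1r.
have nR (x : R) : `|x%:C| = `|x|%:C :> R[i] by rewrite normc_def /= expr0n addr0 sqrtr_sqr.
rewrite !nR -rmorphD -mulrA bE -(rmorph_nat (real_complex R)) -rmorphM lecR.
have := lP M; have := kP M; lra.
Qed.

Lemma complex_geometric_archimedean : geometric_archimedean R[i].
Proof.
move=> a b C q C0 q0 q2 aC.
have CE : C = (complex.Re C)%:C by rewrite RRe_real ?ger0_real.
have qE : q = (complex.Re q)%:C by rewrite RRe_real ?ger0_real.
rewrite CE qE in C0 q0 q2 aC; move: (complex.Re C) (complex.Re q) C0 q0 q2 aC => {CE qE}c {}q.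
rewrite !ler0c => c0 q0 q2 aC.
have {}q2 : q <= 2^-1.
  by rewrite -lecR (le_trans q2) // fmorphV rmorph_nat.
have bE m : c%:C * q%:C ^+ m = (c * q ^+ m)%:C :> R[i] by rewrite rmorphM rmorphXn.
have aE M : (complex.Im a == complex.Im b) && (complex.Re a <= complex.Re b + c * q ^+ M).
  have := aC M; rewrite bE lecE; case: (a) (b) => [a1 a2] [b1 b2] /=.
  by rewrite addr0 eq_sym.
have /andP[/eqP abI _] := aE 0%N; rewrite lecE abI eqxx /=.
apply/ler_addgt0Pr => e e0.
have [M Mc] : exists M, c * q ^+ M <= e.
  have [M Mce] : exists M : nat, c / e <= M%:R.
    exists (Num.bound (c / e)); apply: ltW.
    by apply: archi_boundP; rewrite divr_ge0 // ltW.
  exists M; rewrite (@le_trans _ _ (c * 2^-1 ^+ M)) ?ler_wpM2l ?lerXn2r ?nnegrE ?invr_ge0 //.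
  rewrite exprVn ler_pdivrMr ?exprn_gt0 // mulrC -ler_pdivrMr //.
  by rewrite (le_trans Mce) // -natrX ler_nat ltnW // ltn_expl.
by have /andP[_ h] := aE M; rewrite (le_trans h) // lerD2l.
Qed.

End Complex.

Section Ball.
Variables (R : realType) (K : numFieldType) (iota : {rmorphism R -> K}).
Hypothesis iota_norm : forall x, `|iota x| = iota `|x|.
Hypothesis iota_le : {mono iota : x y / x <= y}.
Hypothesis iota_above : forall w : K, exists c, `|w| <= iota c.
Hypothesis iota_below : forall e : K, 0 < e -> exists2 d, 0 < d & iota d <= e.
Local Open Scope classical_set_scope.

Lemma segment_continuous (z w : K) : continuous (fun t : R => z + iota t * w).
Proof.
move=> t; apply/cvgrPdist_le => e e0.
have [c wc] := iota_above w; have [d d0 de] := iota_below e0.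
have c0 : 0 <= c by rewrite -iota_le rmorph0 (le_trans _ wc).
near=> t'.
rewrite opprD addrACA subrr add0r -mulrBl -rmorphB normrM iota_norm.
apply: le_trans de; apply: (@le_trans _ _ (iota (`|t - t'| * c))).
  by rewrite rmorphM ler_wpM2l // -iota_norm.
rewrite iota_le (@le_trans _ _ (d / (c + 1) * c)) //.
  rewrite ler_wpM2r //; near: t'.
  by apply: (@cvgr_dist_le _ _ _ _ _ id) => //; rewrite divr_gt0 // ltr_wpDl.
rewrite mulrAC ler_pdivrMr ?ltr_wpDl // ler_wpM2l ?(ltW d0) //; lra.
Unshelve. all: by end_near. Qed.

(** A ball is star-shaped: it is the union of the segments from its centre. *)
Lemma ball_connected (z r : K) : connected (ball z r).
Proof.
have -> : ball z r = \bigcup_(w in ball z r) ((fun t : R => z + iota t * (w - z)) @` `[0, 1]).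
  apply/seteqP; split=> [w bw|w [v bv [t t01 <-]]].
    exists w => //; exists 1; rewrite /= ?in_itv /= ?ler01 ?lexx //.
    by rewrite rmorph1 mul1r addrC subrK.
  move: t01 bv; rewrite /= in_itv /= => /andP[t0 t1]; rewrite -ball_normE /= => bv.
  rewrite opprD addrA subrr add0r normrN normrM iota_norm (ger0_norm t0) distrC.
  apply: le_lt_trans bv; rewrite ler_piMl //.
  by rewrite -(rmorph1 iota) iota_le.
apply: bigcup_connected.
  exists z => w bw; exists 0; rewrite /= ?in_itv /= ?lexx ?ler01 //.
  by rewrite rmorph0 mul0r addr0.
move=> w bw; apply: connected_continuous_connected.
  exact: segment_connected.
by apply: continuous_subspaceT; apply: segment_continuous.
Qed.

End Ball.

Lemma complex_ball_connected (R : realType) (z r : R[i]) :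
  connected (ball (z : (R[i] : numFieldType)) r).
Proof.
apply: (ball_connected (iota := real_complex R)) => [x|x y|w|e e0].
- by rewrite normc_def /= expr0n addr0 sqrtr_sqr.
- exact: lecR.
- have wE : real_complex R (complex.Re `|w|) = `|w| := RRe_real (normr_real _).
  by exists (complex.Re `|w|); rewrite le_eqVlt; apply/orP; left; apply/eqP/esym.
- have eE : real_complex R (complex.Re e) = e := RRe_real (gtr0_real e0).
  exists (complex.Re e); last by rewrite le_eqVlt; apply/orP; left; apply/eqP.
  by rewrite -ltcR; move: e0; rewrite -{1}eE.
Qed.

(** * Solutions near a regular point *)

Section Derivative.
Variable K : numFieldType.
Implicit Types f : K -> K.
Local Open Scope classical_set_scope.

Lemma derivative_of_quadratic_error f (z g s D : K) : 0 < s -> 0 <= D ->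
  (forall h, `|h| <= s -> `|f (h + z) - f z - h * g| <= D * `|h| ^+ 2) ->
  derivable f z 1 /\ derive1 f z = g.
Proof.
move=> s0 D0 fh.
have lim : h^-1 *: (f (h + z) - f z) @[h --> 0^'] --> g.
  apply/cvgrPdist_le => e e0; near=> h.
  have h0 : h != 0 by near: h; apply: nbhs_dnbhs_neq.
  have hs : `|h| <= s by near: h; apply: dnbhs0_le.
  have he : `|h| <= e / (D + 1) by near: h; apply: dnbhs0_le; rewrite divr_gt0 // ltr_wpDl.
  have -> : g - h^-1 *: (f (h + z) - f z) = - (h^-1 * (f (h + z) - f z - h * g)).
    have -> : h^-1 *: (f (h + z) - f z) = h^-1 * (f (h + z) - f z) by [].
    by rewrite (mulrBr h^-1 (_ - _)) mulrA mulVf // mul1r opprB.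
  rewrite normrN normrM normfV ler_pdivrMl ?normr_gt0 // (le_trans (fh h hs)) //.
  rewrite expr2 mulrCA ler_wpM2l // (le_trans (ler_wpM2l D0 he)) //.
  by rewrite mulrCA ler_piMr ?(ltW e0) // ler_pdivrMr ?mul1r ?lerDl // ltr_wpDl.
split; last exact: (cvg_lim _ lim).
apply/cvg_ex; exists g.
have -> // : (fun h => h^-1 *: ((f \o shift z) (h *: 1) - f z))
    = (fun h => h^-1 *: (f (h + z) - f z)).
by apply/funext => h; rewrite /= [_%:A]mulr1.
Unshelve. all: by end_near. Qed.

End Derivative.

Section AlgebraicTaylor.
Variable K : numFieldType.

(** The product [D] of the denominators is used twice: once to clear them, and
    once more so that the equation holds trivially at the poles, where the
    original equation says nothing. *)
Lemma algebraic_function_poly (U : set K) (f : K -> K) : algebraic_function U f ->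
  exists2 P : {poly {poly K}}, P != 0 & forall z, U z -> P.[(f z)%:P].[z] = 0.
Proof.
move=> [P P0 Pf].
pose D := \prod_(k < size P) rfden P`_k.
pose c (k : nat) := rfnum P`_k * (\prod_(l < size P | (l != k :> nat)) rfden P`_l) * D.
have den0 k : rfden P`_k != 0 by apply: rfden_neq0.
have D0 : D != 0 by apply/prodf_neq0 => k _.
have cE (k : 'I_(size P)) z : D.[z] != 0 -> (c k).[z] = rfval z P`_k * (D.[z] * D.[z]).
  rewrite /c !hornerM mulrA => Dz; congr (_ * _).
  have -> : D.[z] = (rfden P`_k).[z] * (\prod_(l < size P | l != k :> nat) rfden P`_l).[z].
    by rewrite -hornerM /D (bigD1 k).
  rewrite mulrA divfK //; apply: contraNneq Dz => kz.
  by rewrite /D (bigD1 k) //= hornerM kz mul0r.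
exists (\poly_(k < size P) c k).
  apply: contra_neq P0 => c0; apply/eqP; rewrite -lead_coef_eq0 lead_coefE.
  have [->|P0] := eqVneq P 0; first by rewrite size_poly0 coef0.
  have sP : ((size P).-1 < size P)%N by rewrite prednK // lt0n size_poly_eq0.
  have := congr1 (fun q : {poly {poly K}} => q`_(size P).-1) c0.
  rewrite coef_poly sP coef0 => /eqP; rewrite !mulf_eq0 (negbTE D0) orbF => /orP[/eqP n0|].
    by rewrite (rfE P`_(size P).-1) n0 rmorph0 mul0r.
  by rewrite prodf_seq_eq0 => /hasP[l _ /andP[_]]; rewrite (negbTE (den0 l)).
move=> z Uz; rewrite horner_poly horner_sum.
have [Dz|Dz] := eqVneq D.[z] 0.
  by rewrite big1 // => k _; rewrite /c !hornerM Dz mulr0 mul0r.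
rewrite (eq_bigr (fun k : 'I_(size P) => rfval z P`_k * f z ^+ k * (D.[z] * D.[z]))); last first.
  by move=> k _; rewrite hornerM cE // horner_exp hornerC mulrAC.
rewrite -mulr_suml Pf ?mul0r // => k.
have [kP|kP] := ltnP k (size P).
  rewrite /rfpole rootE; apply: contraNneq Dz => kz.
  by rewrite /D (bigD1 (Ordinal kP)) //= hornerM kz mul0r.
rewrite nth_default //.
have -> : 0 = tofrac 0 / tofrac 1 :> ratfun K by rewrite rmorph0 mul0r.
by apply: rfpole_frac; rewrite hornerC oner_neq0.
Qed.

Hypotheses (Kc : geometric_complete K) (Kl : geometric_archimedean K).
Hypothesis Kball : forall z r : K, connected (ball z r).

Variables (n : nat) (A : 'M[ratfun K]_n) (Delta : {poly K}) (B : 'M[{poly K}]_n).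
Hypothesis AB : forall i j, tofrac Delta * A i j = tofrac (B i j).
Variable z0 : K.
Hypothesis Delta_z0 : Delta.[z0] != 0.
Let sh : {poly K} := 'X + z0%:P.
Let Ds := Delta \Po sh.
Let Bs := map_mx (comp_poly sh) B.

Lemma horner_shift (p : {poly K}) x : (p \Po sh).[x] = p.[x + z0].
Proof. by rewrite horner_comp hornerD hornerX hornerC. Qed.

Lemma shifted_Delta0 : Ds`_0 != 0.
Proof. by rewrite -horner_coef0 horner_shift add0r. Qed.

(** Stated in terms of the bound [rho] for the growth of coefficients, because
    enlarging [rho] is how the disc of convergence is shrunk to avoid the zeros of
    [Delta]. *)
Lemma polynomial_nonzero_near0 (p : {poly K}) : p`_0 != 0 ->
  exists2 c, 0 < c & forall rho x, c <= rho -> `|x| <= (8 * rho)^-1 -> p.[x] != 0.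
Proof.
move=> p0; have p0' : 0 < `|p`_0| by rewrite normr_gt0.
pose q := drop_poly 1 (p - (p`_0)%:P).
have pE : p = 'X * q + (p`_0)%:P.
  by rewrite /q -coef0_mulX ?subrK // coefB coefC subrr.
pose W := wnorm 1 q; have W0 : 0 <= W by apply: wnorm_ge0.
exists (1 + W / `|p`_0|); first by rewrite ltr_wpDr // divr_ge0.
move=> rho x cr xr.
have r1 : 1 <= rho by rewrite (le_trans _ cr) // lerDl divr_ge0.
have r0 : 0 < rho by rewrite (lt_le_trans _ r1).
have rW : W < rho * `|p`_0|.
  by rewrite -ltr_pdivrMr // (lt_le_trans _ cr) // ltrDr.
have r8 : 0 < 8 * rho by rewrite mulr_gt0.
have x1 : `|x| <= 1.
  rewrite (le_trans xr) // invf_le1 // (le_trans r1) // ler_peMl ?(ltW r0) //.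
  by rewrite ler1n.
have xW : `|x * q.[x]| < `|p`_0|.
  rewrite normrM (@le_lt_trans _ _ ((8 * rho)^-1 * W)) //.
    by rewrite ler_pM // wnorm_horner.
  rewrite mulrC ltr_pdivrMr // (lt_le_trans rW) // mulrC ler_wpM2l // ler_peMl ?(ltW r0) //.
  by rewrite ler1n.
apply: contraTneq xW => px0; rewrite -[X in X < _]normrN.
have -> : - (x * q.[x]) = p`_0.
  by move: px0; rewrite {1}pE !hornerE => /eqP; rewrite addrC addr_eq0 => /eqP.
by rewrite ltxx.
Qed.

Lemma rfval_system x i j : Ds.[x] != 0 -> rfval (x + z0) (A i j) = (Bs i j).[x] / Ds.[x].
Proof.
rewrite mxE !horner_shift => Dx.
have D0 : tofrac Delta != 0 :> ratfun K.
  by rewrite tofrac_eq0; apply: contraNneq Dx => ->; rewrite horner0.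
have -> : A i j = tofrac (B i j) / tofrac Delta by rewrite -AB mulrAC divff ?mul1r.
exact: rfval_frac.
Qed.

Lemma local_solution (v : 'I_n -> K) :
  exists s C rho, [/\ 0 < s, 0 <= C, 0 <= rho & exists2 y, is_solution A (ball z0 s) y &
    forall i x, `|x| < s -> forall M,
      `|(trunc (solution_coef Ds Bs v i) M).[x] - y (x + z0) i 0| <= C * (rho * `|x|) ^+ M].
Proof.
have [rho0 r00 bnd] := solution_coef_bound Bs shifted_Delta0.
have [C C0 bC0] := bnd v; have [c c0 nz] := polynomial_nonzero_near0 shifted_Delta0.
pose rho := rho0 + c; have r0 : 0 < rho by rewrite addr_gt0.
have bC i m : `|solution_coef Ds Bs v i m| <= C * rho ^+ m.
  rewrite (le_trans (bC0 i m)) // ler_wpM2l // lerXn2r ?nnegrE ?(ltW r0) ?(ltW r00) //.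
  by rewrite lerDl ltW.
pose s := (8 * rho)^-1; have s0 : 0 < s by rewrite invr_gt0 mulr_gt0.
have nz' x : `|x| <= s -> Ds.[x] != 0 by apply: nz; rewrite lerDr ltW.
have /choice[f fP] i : exists f g, sums_to (solution_coef Ds Bs v i) C rho f g.
  exact: power_series_sum.
have {fP}/choice[g fP] := fP.
have f4 i x : `|x| <= s -> forall M,
    `|(trunc (solution_coef Ds Bs v i) M).[x] - f i x| <= 4 * C * (rho * `|x|) ^+ M.
  move=> xs; have [+ _ _] := fP i; apply; apply: (le_trans xs).
  by apply: ler_peMl; rewrite ?(ltW s0) ?ler1n.
exists s, (4 * C), rho; split; rewrite ?mulr_ge0 ?(ltW r0) //.
pose y z : 'cV[K]_n := \col_i f i (z - z0).
have dy i z : ball z0 s z -> derivable (fun w => y w i 0) z 1 /\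
     derive1 (fun w => y w i 0) z = g i (z - z0).
  rewrite -ball_normE /= distrC => zs.
  apply: (@derivative_of_quadratic_error _ _ _ _ s (2 * C / s ^+ 2)) => //.
    by rewrite !mulr_ge0 // invr_ge0 exprn_ge0 // ltW.
  move=> h hs; rewrite !mxE (_ : h + z - z0 = z - z0 + h); last by ring.
  by have [_ _] := fP i; apply => //; apply: ltW.
exists y; last first.
  by move=> i x xs M; rewrite mxE addrK; apply: f4; apply: ltW.
split; first exact: ball_open.
- exact: Kball.
- by move=> z i /(dy i)[].
move=> z zs _; have zs' : `|z - z0| <= s.
  by move: zs; rewrite -ball_normE /= distrC => /ltW.
pose x := z - z0; have zE : z = x + z0 by rewrite subrK.
apply/colP => i; rewrite !mxE (dy i z zs).2.
have half1 : rho * `|x| <= 2^-1.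
  rewrite (@le_trans _ _ (rho * s)) ?ler_wpM2l ?(ltW r0) //.
  have -> : rho * s = 8^-1 by rewrite /s; field; rewrite gt_eqF.
  by rewrite lef_pV2 ?posrE ?ler_nat.
have half2 : 2 * rho * `|x| <= 2^-1.
  rewrite (@le_trans _ _ (2 * rho * s)) ?ler_wpM2l ?mulr_ge0 ?(ltW r0) //.
  have -> : 2 * rho * s = 4^-1 by rewrite /s; field; rewrite gt_eqF.
  by rewrite lef_pV2 ?posrE ?ler_nat.
pose c' := 4 * C + 4 * (C * rho).
have c1 : 0 <= 4 * C by rewrite mulr_ge0.
have c2 : 0 <= 4 * (C * rho) by rewrite !mulr_ge0 ?(ltW r0).
have half_bnd e e' q M : 0 <= e -> 0 <= e' -> 0 <= q -> q <= 2^-1 ->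
    e * q ^+ M <= (e + e') * 2^-1 ^+ M :> K.
  move=> e0 e0' q0 q2; rewrite ler_pM ?exprn_ge0 ?lerDl //.
  by rewrite lerXn2r ?nnegrE ?invr_ge0.
have DgE : Ds.[x] * g i x = \sum_j (Bs i j).[x] * f j x.
  apply: (@formal_solution_sum K Kl n Ds Bs (solution_coef Ds Bs v) C rho c' x
      (fun j => f j x) (fun j => g j x)) => //.
  - by move=> M; apply: solution_coef_formal shifted_Delta0 _ _.
  - by rewrite addr_ge0.
  - move=> j M; apply: le_trans (f4 j x zs' M) _; apply: half_bnd => //.
    by rewrite mulr_ge0 ?(ltW r0).
  - move=> j M; have [_ + _] := fP j => /(_ x zs' M) h; apply: le_trans h _.
    rewrite /c' [4 * C + _]addrC; apply: half_bnd => //.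
    by rewrite !mulr_ge0 ?(ltW r0).
apply: (mulfI (nz' x zs')); rewrite DgE mulr_sumr; apply: eq_bigr => j _.
rewrite [map_mx (rfval z) A i j]mxE [y z j 0]mxE zE rfval_system ?nz' // addrK.
by rewrite mulrA mulrCA divff ?nz' // mulr1.
Qed.

(** Shifting the equation of the solution [y] by [z0] gives an equation for its
    Taylor series at [z0]. *)
Lemma algebraic_taylor (v : 'I_n -> K) i :
  (forall U y, is_solution A U y -> forall i, algebraic_function U (fun z => y z i 0)) ->
  exists2 P, P != 0 & series_root P (solution_coef Ds Bs v i).
Proof.
move=> alg; have [s [C [rho [s0 C0 r0 [y sol yP]]]]] := local_solution v.
have [P P0 Py] := algebraic_function_poly (alg _ _ sol i).
exists (map_poly (comp_poly sh) P).
  rewrite map_poly_eq0_id0 // comp_poly_eq0 ?lead_coef_eq0 //.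
  by rewrite size_XaddC.
have s2 : s / 2 < s by rewrite ltr_pdivrMr // ltr_pMr // ltr1n.
apply: (@series_root_of_vanishing K Kl _ _ C rho (s / 2) (fun x => y (x + z0) i 0)) => //.
- by rewrite divr_gt0.
- by move=> x xs M; apply: yP; apply: le_lt_trans s2.
move=> x xs.
have -> : (map_poly (comp_poly sh) P).[(y (x + z0) i 0)%:P].[x]
    = P.[(y (x + z0) i 0)%:P].[x + z0].
  rewrite -horner_shift -[in RHS](horner_map (comp_poly sh)) /= comp_polyC //.
apply: Py; rewrite -ball_normE /= opprD addrCA subrr addr0 normrN.
exact: le_lt_trans s2.
Qed.

End AlgebraicTaylor.

(** * A transcendental point *)

Section Generated.
Variables (L : nzRingType) (s : seq L).

(** Ring expressions in the elements of [s], encoded by trees with natural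
    numbers at their leaves because these form a countable type. *)
Fixpoint ring_eval (t : GenTree.tree nat) : L :=
  match t with
  | GenTree.Leaf i => s`_i
  | GenTree.Node 0 [:: t1; t2] => ring_eval t1 - ring_eval t2
  | GenTree.Node 1 [:: t1; t2] => ring_eval t1 * ring_eval t2
  | _ => 1
  end.

Definition ring_generated : {pred L} := [pred x | `[< exists t, ring_eval t = x >]].

Lemma ring_generatedP x : reflect (exists t, ring_eval t = x) (x \in ring_generated).
Proof. exact: asboolP. Qed.

Lemma ring_generated_closed : subring_closed ring_generated.
Proof.
split; first by apply/ring_generatedP; exists (GenTree.Node 2 [::]).
- move=> x y /ring_generatedP[t <-] /ring_generatedP[u <-].
  by apply/ring_generatedP; exists (GenTree.Node 0 [:: t; u]).
- move=> x y /ring_generatedP[t <-] /ring_generatedP[u <-].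
  by apply/ring_generatedP; exists (GenTree.Node 1 [:: t; u]).
Qed.

HB.instance Definition _ :=
  GRing.isSubringClosed.Build L ring_generated ring_generated_closed.

Lemma mem_ring_generated : {subset s <= ring_generated}.
Proof.
by move=> x /(nthP 0)[i _ <-]; apply/ring_generatedP; exists (GenTree.Leaf i).
Qed.

Lemma countable_ring_generated : countable [set x | x \in ring_generated].
Proof.
apply: (@sub_countable _ _ _ (range ring_eval)); last first.
  apply: sub_countable (countableP [set: GenTree.tree nat]).
  exact: card_image_le.
by apply: subset_card_le => x /= /ring_generatedP[t <-]; exists t.
Qed.

End Generated.

(** If [s] generates [S], then ['X] and the constants from [s] generate a
    countable ring that contains all polynomials over [S]: the constants in it
    form a subring containing [s]. *)
Lemma countable_polyOver (K : numFieldType) (S : subringClosed K) :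
  finitely_generated_ring S -> countable [set q : {poly K} | q \is a polyOver S].
Proof.
move=> [s sS Smin]; pose gens : seq {poly K} := 'X :: [seq c%:P | c <- s].
pose G := ring_generated gens.
have XG : 'X \in G by apply: mem_ring_generated; rewrite inE eqxx.
pose T : {pred K} := [pred c | c%:P \in G].
have TE c : (c \in T) = (c%:P \in G) by [].
have Tclosed : subring_closed T.
  split; first by rewrite TE rpred1.
  - by move=> x y xT yT; rewrite TE polyCB rpredB.
  - by move=> x y xT yT; rewrite TE polyCM rpredM.
pose Tr : subringClosed K := HB.pack T (GRing.isSubringClosed.Build K T Tclosed).
have ST : {subset S <= T}.
  apply: (Smin Tr) => c cs; rewrite -[_ \in _]/(c%:P \in G); apply: (@mem_ring_generated _ gens).
  by rewrite inE map_f ?orbT.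
apply: sub_countable (countable_ring_generated gens).
apply: subset_card_le => q /= qS; rewrite -/G -[q]coefK poly_def rpred_sum // => i _.
rewrite -mul_polyC rpredM ?rpredX //; apply: ST; exact: (polyOverP qS).
Qed.

Section Transcendental.
Variable R : realType.

(** A countable set is null, but the unit interval has measure one. *)
Lemma uncountable_real : ~ countable [set: R].
Proof.
move=> cT; have : countable `[0%R, (1 : R)]%classic.
  by apply: sub_countable cT; apply: subset_card_le.
move/countable_lebesgue_measure0; rewrite lebesgue_measure_itv /= lte_fin ltr01.
by rewrite -EFinB subr0 => -[] /eqP; rewrite oner_eq0.
Qed.

(** Countably many nonzero polynomials have countably many roots, so they miss
    some real number. *)
Lemma exists_transcendental (S : subringClosed R[i]) : finitely_generated_ring S ->
  exists z0 : R[i], forall q, q \is a polyOver S -> q.[z0] = 0 -> q = 0.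
Proof.
move=> /countable_polyOver cS; apply: contrapT => /forallNP nt.
apply: uncountable_real.
pose PS := [set q : {poly R[i]} | q \is a polyOver S]%classic.
apply: (@sub_countable _ _ _
  (\bigcup_(q in PS) [set x : R | q != 0 /\ root q (real_complex R x)])%classic).
  apply: subset_card_le => x _.
  have /existsNP[q /not_implyP[qS /not_implyP[q0 qn0]]] := nt (real_complex R x).
  by exists q => //=; split; [exact/eqP | apply/eqP].
apply: bigcup_countable => // q _.
have [r qr] := closed_field_poly_normal q.
apply: (@sub_countable _ _ _ [set` [seq complex.Re z | z <- r]]%classic);
  last exact: finite_set_countable.
apply: subset_card_le => x /= [q0]; rewrite qr rootZ ?lead_coef_eq0 // root_prod_XsubC => xr.
by apply/mapP; exists (real_complex R x).
Qed.

End Transcendental.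

(** * Denominators of the matrices [A_m] *)

Section Values.
Variables (K : fieldType) (S : subringClosed K) (z0 : K).

(** The ring [S[z0]]. *)
Definition poly_values : {pred K} :=
  [pred x | `[< exists2 q, q \is a polyOver S & q.[z0] = x >]].

Lemma poly_valuesP x :
  reflect (exists2 q, q \is a polyOver S & q.[z0] = x) (x \in poly_values).
Proof. exact: asboolP. Qed.

Lemma poly_values_closed : subring_closed poly_values.
Proof.
split; first by apply/poly_valuesP; exists 1; rewrite ?rpred1 ?hornerC.
- move=> x y /poly_valuesP[p pS <-] /poly_valuesP[q qS <-].
  by apply/poly_valuesP; exists (p - q); rewrite ?rpredB // !hornerE.
- move=> x y /poly_valuesP[p pS <-] /poly_valuesP[q qS <-].
  by apply/poly_valuesP; exists (p * q); rewrite ?rpredM // !hornerE.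
Qed.

HB.instance Definition _ :=
  GRing.isSubringClosed.Build K poly_values poly_values_closed.

Lemma horner_poly_values q : q \is a polyOver S -> q.[z0] \in poly_values.
Proof. by move=> qS; apply/poly_valuesP; exists q. Qed.

End Values.

Lemma common_geometric_denominator (K : fieldType) (A : subringClosed K) (I : finType)
    (a : I -> nat -> K) : (forall i, geometric_denominators A (a i)) ->
  exists2 D, D \in A & D != 0 /\ forall i m, (0 < m)%N -> D ^+ m * a i m \in A.
Proof.
move=> ad; pose D i := projT1 (cid2 (ad i)).
have DP i : [/\ D i \in A, D i != 0 & forall m, (0 < m)%N -> D i ^+ m * a i m \in A].
  by rewrite /D; case: cid2 => d dA [].
exists (\prod_i D i); first by rewrite rpred_prod // => i _; case: (DP i).
split; first by apply/prodf_neq0 => i _; case: (DP i).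
move=> i m m0; rewrite (bigD1 i) //= exprMn mulrAC; apply: rpredM.
  by have [_ _] := DP i; apply.
by rewrite rpredX // rpred_prod // => j _; case: (DP j).
Qed.

Section TaylorDenominators.
Variables (K : numFieldType) (n : nat) (S : subringClosed K).
Variables (Delta : {poly K}) (B : 'M[{poly K}]_n) (z0 : K).
Hypothesis Delta_S : Delta \is a polyOver S.
Hypothesis B_S : forall i j, B i j \is a polyOver S.
Hypothesis Delta_z0 : Delta.[z0] != 0.
Hypothesis z0_transc : forall q, q \is a polyOver S -> q.[z0] = 0 -> q = 0.
Let Ds := Delta \Po ('X + z0%:P).
Let Bs := map_mx (comp_poly ('X + z0%:P)) B.
Let unit_vector (j : 'I_n) (k : 'I_n) : K := (k == j)%:R.

Lemma solution_coefE i j m :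
  solution_coef Ds Bs (unit_vector j) i m
  = (numer Delta B m i j).[z0] / (m`!%:R * Delta.[z0] ^+ m).
Proof.
have ev (p : {poly K}) : (p \Po ('X + z0%:P))`_0 = p.[z0].
  by rewrite -horner_coef0 horner_comp !hornerE.
rewrite /solution_coef ev (bigD1 j) //= /unit_vector eqxx mulr1 numer_comp ev.
by rewrite big1 ?addr0 // => k kj; rewrite (negbTE kj) mulr0.
Qed.

Lemma solution_coef_fracs i j m :
  solution_coef Ds Bs (unit_vector j) i m \in fracs (poly_values S z0).
Proof.
rewrite solution_coefE; set d := (X in _ / X).
have d0 : d != 0 by rewrite mulf_neq0 ?expf_neq0 // pnatr_eq0 -lt0n fact_gt0.
apply: (@fracs_div _ _ _ d) => //.
  by rewrite rpredM ?rpred_nat ?rpredX ?horner_poly_values.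
by rewrite mulrC divfK // horner_poly_values // numer_over.
Qed.

(** Eisenstein's theorem at the transcendental point [z0], for all entries at
    once, yields [q^m P_m / m! = Delta^m w]: both sides are polynomials over [S]
    after multiplication by [m!], and they agree at [z0].  The leading
    coefficient of [q] then provides [N]; its exponent is [m] for the division
    by [q^m] plus [m * d] for the degree of [P_m]. *)
Lemma numer_denominators :
  (forall i j, exists2 P, P != 0 & series_root P (solution_coef Ds Bs (unit_vector j) i)) ->
  exists2 N, N \in S & N != 0 /\ forall m i j,
    N ^+ m *: ((m`!%:R)^-1 *: numer Delta B m i j) \is a polyOver S.
Proof.
move=> alg; pose A := poly_values S z0.
have [D DA [D0 Dm]] : exists2 D, D \in A & D != 0 /\
    forall (ij : 'I_n * 'I_n) m, (0 < m)%N ->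
      D ^+ m * solution_coef Ds Bs (unit_vector ij.2) ij.1 m \in A.
  apply: common_geometric_denominator => -[i j] /=.
  have [P P0 Pr] := alg i j.
  have [P' P'A [P'0 P'r]] := algebraic_descent (solution_coef_fracs i j) P0 Pr.
  by apply: eisenstein P'A P'0 P'r; [exact: pchar_num | exact: solution_coef_fracs].
have /poly_valuesP[q qS qD] := DA.
have q0 : q != 0 by apply: contraNneq D0 => q0; rewrite -qD q0 horner0.
have [d sN] := size_numer Delta B.
exists (lead_coef q ^+ d.+1); first by rewrite rpredX // (polyOverP qS).
rewrite expf_neq0 ?lead_coef_eq0 //; split=> // m i j.
have fm0 : m`!%:R != 0 :> K by rewrite pnatr_eq0 -lt0n fact_gt0.
case: (posnP m) => [->|m0].
  by rewrite expr0 fact0 invr1 !scale1r mxE rpredMn // rpred1.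
rewrite -exprM mulSn mulnC; apply: divide_by_power => //; last first.
  by apply: leq_trans (size_scale_leq _ _) _; apply: sN.
have /poly_valuesP[w wS wE] := Dm (i, j) m m0.
suff -> : q ^+ m * ((m`!%:R)^-1 *: numer Delta B m i j) = Delta ^+ m * w.
  by rewrite rpredM ?rpredX.
rewrite -scalerAr; apply: (scalerI fm0); rewrite scalerA divff // scale1r.
apply/eqP; rewrite -subr_eq0; apply/eqP; apply: z0_transc.
  rewrite rpredB ?rpredM ?rpredX ?numer_over // -mul_polyC rpredM ?rpredM ?rpredX //.
  by rewrite polyOverC rpred_nat.
rewrite !hornerE /= wE qD solution_coefE; field.
by rewrite expf_neq0.
Qed.

End TaylorDenominators.

Section Conclusions.
Variables (K : numFieldType) (n : nat) (S : subringClosed K).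
Variables (A : 'M[ratfun K]_n) (Delta : {poly K}) (B : 'M[{poly K}]_n) (N : K).
Hypothesis Delta_neq0 : Delta != 0.
Hypothesis AB : forall i j, tofrac Delta * A i j = tofrac (B i j).
Hypothesis N_neq0 : N != 0.
Hypothesis N_numer : forall m i j,
  N ^+ m *: ((m`!%:R)^-1 *: numer Delta B m i j) \is a polyOver S.

Lemma natr_ratfun m : m%:R = tofrac m%:R%:P :> ratfun K.
Proof. by rewrite polyC_natr rmorph_nat. Qed.

Lemma fact_ratfun_neq0 m : m`!%:R != 0 :> ratfun K.
Proof. by rewrite natr_ratfun tofrac_eq0 polyC_eq0 pnatr_eq0 -lt0n fact_gt0. Qed.

Lemma sysder_divided m i j :
  tofrac (N *: Delta) ^+ m * sysder A m i j / m`!%:R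
  = tofrac (N ^+ m *: ((m`!%:R)^-1 *: numer Delta B m i j)).
Proof.
have D0 : tofrac Delta != 0 :> ratfun K by rewrite tofrac_eq0.
have cancel (F : fieldType) (a b c f : F) : b != 0 -> a * b * (c / b) * f = a * (f * c).
  by move=> b0; field.
have fV : tofrac ((m`!%:R)^-1)%:P = (m`!%:R)^-1 :> ratfun K.
  apply: (mulIf (fact_ratfun_neq0 m)); rewrite mulVf ?fact_ratfun_neq0 //.
  rewrite natr_ratfun -rmorphM -polyCM mulVf ?rmorph1 //.
  by rewrite pnatr_eq0 -lt0n fact_gt0.
rewrite (sysder_numer Delta_neq0 AB) -!mul_polyC !rmorphM /=.
rewrite fV rmorphXn /= rmorphXn exprMn.
exact: cancel (expf_neq0 m D0).
Qed.

Lemma sysder_in_polyring m i j :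
  in_polyring S (tofrac (N *: Delta) ^+ m * sysder A m i j / m`!%:R).
Proof.
rewrite sysder_divided.
by exists (N ^+ m *: ((m`!%:R)^-1 *: numer Delta B m i j)).
Qed.

Lemma sysder_divisible p k m i j : prime p -> (k <= logn p m`!)%N ->
  exists2 g, in_localized_polyring S (N *: Delta) g & sysder A m i j = (p ^ k)%:R * g.
Proof.
move=> pp km.
have ND0 : tofrac (N *: Delta) != 0 :> ratfun K.
  by rewrite tofrac_eq0 scaler_eq0 negb_or N_neq0.
have /dvdnP[t tE] : (p ^ k %| m`!)%N by rewrite pfactor_dvdn ?fact_gt0.
have := sysder_divided m i j; have := N_numer m i j.
set q := N ^+ m *: _ => qS qE.
exists (tofrac (t%:R * q) / tofrac (N *: Delta) ^+ m).
  by exists (t%:R * q); [rewrite rpredM ?rpred_nat | exists m].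
have cancel (F : fieldType) (a b c d e f : F) :
    a != 0 -> b != 0 -> a * c / b = f -> b = e * d -> c = d * (e * f / a).
  move=> a0 b0 <- bE; move: b0; rewrite bE mulf_eq0 negb_or => /andP[e0 d0].
  by field; rewrite a0 e0 d0.
rewrite rmorphM rmorph_nat.
apply: (cancel _ _ _ _ _ _ _ (expf_neq0 m ND0) (fact_ratfun_neq0 m) qE).
by rewrite -natrM tE.
Qed.

End Conclusions.

Theorem theorem1p1 (R : realType) (n : nat)
  (A : 'M[ratfun R[i]]_n) (Delta : {poly R[i]}) (S : subringClosed R[i])
  (Delta_neq0 : Delta != 0)
  (S_fg : finitely_generated_ring S)
  (Delta_S : Delta \is a polyOver S)
  (DeltaA_S : forall i j, in_polyring S (tofrac Delta * A i j))
  (solutions_algebraic : forall (U : set R[i]) (y : R[i] -> 'cV[R[i]]_n),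
     is_solution A U y ->
     forall i, algebraic_function U (fun z => y z i 0)) :
  exists N : R[i],
    [/\ N \in S, N != 0,
        forall (m : nat) i j,
          in_polyring S (tofrac (N *: Delta) ^+ m * sysder A m i j / m`!%:R)
      & forall p k m : nat, prime p -> (k <= logn p m`!)%N ->
          forall i j,
          exists2 g : ratfun R[i],
            in_localized_polyring S (N *: Delta) g
            & sysder A m i j = (p ^ k)%:R * g].
Proof.
have [z0 z0_transc] := exists_transcendental S_fg.
have Delta_z0 : Delta.[z0] != 0.
  by apply: contra_neq Delta_neq0; apply: z0_transc.
pose B := \matrix_(i, j) projT1 (cid2 (DeltaA_S i j)).
have BP i j : B i j \is a polyOver S /\ tofrac Delta * A i j = tofrac (B i j).
  by rewrite mxE; case: cid2.
have [N NS [N0 NP]] : exists2 N, N \in S & N != 0 /\ forall m i j,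
    N ^+ m *: ((m`!%:R)^-1 *: numer Delta B m i j) \is a polyOver S.
  apply: (numer_denominators Delta_S _ Delta_z0 z0_transc) => [i j|i j].
    by case: (BP i j).
  apply: (algebraic_taylor (@complex_geometric_complete R)
    (@complex_geometric_archimedean R) _ _ Delta_z0 _ _ solutions_algebraic).
    exact: complex_ball_connected.
  by move=> k l; case: (BP k l).
exists N; split=> // [m i j|p k m pp km i j].
  exact: (sysder_in_polyring Delta_neq0 (fun i j => (BP i j).2) NP).
exact: (sysder_divisible Delta_neq0 (fun i j => (BP i j).2) N0 NP).
Qed.
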